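(* Let $\alpha$ be a fixed irrational real number whose irrationality exponent $\eta$ is finite, and let $\varepsilon>0$. If $2\le \eta\le \frac52$, then \[ \sum_{n\le x}\mu(n)e(\alpha n)\ll_{\varepsilon} x^{\frac45+\varepsilon} \] as $x\to\infty$. If $\eta\ge \frac52$, then \[ \sum_{n\le x}\mu(n)e(\alpha n)\ll_{\varepsilon} x^{\frac{2\eta-1}{2\eta}+\varepsilon} \] as $x\to\infty$. (The implied constants may depend on $\varepsilon$ and on the fixed number $\alpha$, but not on $x$.)
   Context: $\mu$ denotes the Möbius function and $e(t)=\exp(2\pi i t)$. The sum runs over positive integers $n\le x$. The irrationality exponent of a real number $\alpha$ is the supremum of the set of real numbers $\tau$ for which the inequality $0<|\alpha-p/q|<q^{-\tau}$ holds for infinitely many integer pairs $(p,q)$ with $q>0$; it is at least $2$ for every irrational $\alpha$. *)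

(* Defs.v *)
From HB Require Import structures.
From mathcomp Require Import all_boot all_order all_algebra.
From mathcomp Require Import complex.
From mathcomp Require Import all_classical all_reals all_analysis.

Set Implicit Arguments.
Unset Strict Implicit.
Unset Printing Implicit Defensive.

Import Order.TTheory GRing.Theory Num.Theory.
Import numFieldNormedType.Exports.

Local Open Scope classical_set_scope.
Local Open Scope ring_scope.
Local Open Scope complex_scope.

Definition squarefree (n : nat) : bool :=
  (0 < n)%N && all (fun p => logn p n <= 1)%N (primes n).

Definition moebius (n : nat) : int :=
  if squarefree n then (-1) ^+ size (primes n) else 0.

(* The additive character e(t) = exp (2 pi i t), by Euler's formula. *)
Definition expi2pi {R : realType} (t : R) : R[i] :=
  cos (2 * pi * t) +i* sin (2 * pi * t).

(* The upper bound is floor x for x >= 0; the sum is empty for x < 1. *)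
Definition moebius_exp_sum {R : realType} (alpha x : R) : R[i] :=
  \sum_(1 <= n < (Num.truncn x).+1) (moebius n)%:~R * expi2pi (alpha * n%:R).

Definition approximations {R : realType} (alpha tau : R) : set (int * int) :=
  [set pq | [/\ 0 < pq.2,
      0 < `|alpha - pq.1%:~R / pq.2%:~R| &
      `|alpha - pq.1%:~R / pq.2%:~R| < pq.2%:~R `^ (- tau)]].

(* The supremum is taken in the extended reals, so Liouville numbers get +oo. *)
Definition irrationality_exponent {R : realType} (alpha : R) : \bar R :=
  ereal_sup [set tau%:E | tau in
    [set tau : R | infinite_set (approximations alpha tau)]].

(* Main.v *)
Require Import Defs.
From mathcomp Require Import all_boot all_order all_algebra.
From mathcomp Require Import complex.
From mathcomp Require Import all_classical all_reals all_analysis.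
From mathcomp Require Import ring lra zify.

Set Implicit Arguments.
Unset Strict Implicit.
Unset Printing Implicit Defensive.

Import Order.TTheory GRing.Theory Num.Theory.
Import numFieldNormedType.Exports.

Local Open Scope classical_set_scope.
Local Open Scope ring_scope.
Local Open Scope complex_scope.

(** Let [|alpha - a/q| <= 1/q^2] with [(a, q) = 1].  Vaughan's identity with both
    cut-offs equal to [U = N^(2/5)] splits the sum up to [N] into a trivial part,
    a type I sum and a type II sum.  Both reduce to
    [sum_(h <= H) min(N/h, 1/|sin (pi alpha h)|) << (N/q + q + H) log N],
    the type II sum after a Cauchy-Schwarz inequality with weights [k] and [1/k],
    which dispenses with a dyadic decomposition.  With the divisor bound this gives
    [N^eps (N q^(-1/2) + N^(4/5) + (N q)^(1/2))].  Finally, for [tau > eta] the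
    approximation [a/q] supplied by Dirichlet's theorem with denominators up to
    [N^(1 - 1/tau)] has [q >> N^(1/tau)], and both terms involving [q] are
    [<< N^(1 - 1/(2 tau))]. *)

(** * The Moebius function *)

(** The exponent [4/5] comes from a balance. With cut-off [U], the type I sum involves [h <= U^2],
    while in the type II sum both variables exceed [U], so the differences [h] stay below [N/U] and
    the square root of the second moment costs [(N * N/U)^(1/2)]. The two costs [U^2] and
    [N * U^(-1/2)] agree at [U = N^(2/5)]. The obstacle is a small [q]: Dirichlet's theorem alone
    gives no lower bound for it. Finiteness of [eta] supplies one, because an error of [1/(q Q)]
    with small [q] and large [Q] contradicts a bound [|alpha - a/q| >> q^(-tau)]. The choice of [Q]
    gives [q] and [N/q] the same upper bound up to a constant, so neither dominates. The resulting
    exponent [1 - 1/(2 tau)] overtakes [4/5] at [tau = 5/2], which is where the theorem changes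
    case. *)

Lemma squarefreeP n :
  reflect ((0 < n)%N /\ forall p, (logn p n <= 1)%N) (squarefree n).
Proof.
apply: (iffP andP) => -[n0 h]; split=> //.
  move=> p; have [/(allP h)//|pn] := boolP (p \in primes n).
  by move: pn; rewrite -logn_gt0 -eqn0Ngt => /eqP->.
by apply/allP => p _.
Qed.

Lemma moebius1 : moebius 1 = 1.
Proof. by []. Qed.

Lemma moebius_norm_le1 n : `|moebius n| <= 1.
Proof. by rewrite /moebius; case: ifP => _; rewrite ?normr0// normrX normrN1 expr1n. Qed.

Lemma moebius_primeM p d : prime p -> (0 < d)%N ->
  moebius (p * d) = if (p %| d)%N then 0 else - moebius d.
Proof.
move=> pp d0; have p0 := prime_gt0 pp.
case: ifP => pd.
  rewrite /moebius; case: squarefreeP => // -[_ /(_ p)].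
  have : (0 < logn p d)%N by rewrite logn_gt0 mem_primes pp d0.
  by rewrite lognM// (logn_prime p pp) eqxx; lia.
have lp : logn p d = 0%N by apply/eqP; rewrite eqn0Ngt logn_gt0 mem_primes pp d0 pd.
have sq : squarefree (p * d) = squarefree d.
  apply/squarefreeP/squarefreeP => -[_ h].
    by split=> // r; have := h r; rewrite lognM//; lia.
  split=> [|r]; first by rewrite muln_gt0 p0.
  rewrite lognM// (logn_prime r pp); case: eqP => [->|_]; last exact: h.
    by rewrite lp.
have szp : size (primes (p * d)) = (size (primes d)).+1.
  rewrite -[RHS]/(size (p :: primes d)); apply: perm_size; apply: uniq_perm.
  - exact: primes_uniq.
  - by rewrite /= primes_uniq mem_primes pd !andbF.
  - by move=> r; rewrite primesM// primes_prime// !inE.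
by rewrite /moebius sq szp; case: ifP => _; rewrite ?oppr0// exprS mulN1r.
Qed.

(** Divisor sums are written over a filtered range with a common bound [N], so that they can be
    exchanged with other sums up to [N]; this returns to the list of divisors for counting and
    pairing. *)
Lemma sum_dvdn_divisors (V : nmodType) (F : nat -> V) n N : (0 < n <= N)%N ->
  \sum_(1 <= d < N.+1 | (d %| n)%N) F d = \sum_(d <- divisors n) F d.
Proof.
case/andP=> n0 nN; rewrite -big_filter; apply: perm_big; apply: uniq_perm.
- by rewrite filter_uniq// iota_uniq.
- exact: divisors_uniq.
move=> d; rewrite mem_filter mem_index_iota -dvdn_divisors//.
by have [dn|//] := boolP (d %| n)%N; have := dvdn_leq n0 dn; have := dvdn_gt0 n0 dn; lia.
Qed.

(* Pairing a divisor [d] prime to [p] with [p * d] cancels the sum, for any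
   prime [p] dividing [n]. *)
Lemma sum_moebius n N : (0 < n <= N)%N ->
  \sum_(1 <= d < N.+1 | (d %| n)%N) moebius d = (n == 1%N)%:R.
Proof.
move=> nN; rewrite sum_dvdn_divisors//; have /andP[n0 _] := nN.
have [->|n1] := eqVneq n 1%N; first by rewrite big_seq1 moebius1.
have pp : prime (pdiv n) by apply: pdiv_prime; lia.
have pn := pdiv_dvd n; move: (pdiv n) pp pn => p pp /dvdnP[m nE].
have p0 := prime_gt0 pp.
have m0 : (0 < m)%N by move: n0; rewrite nE; case: (m).
rewrite (bigID (fun d => p %| d)%N) /=.
rewrite [X in X + _](_ : _ = - \sum_(d <- divisors m | ~~ (p %| d)%N) moebius d).
  rewrite -[X in _ + X]big_filter -[X in - X]big_filter.
  rewrite [X in _ + X](_ : _ = \sum_(d <- [seq d <- divisors m | ~~ (p %| d)%N]) moebius d).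
    by rewrite addNr.
  apply: perm_big; apply: uniq_perm; rewrite ?filter_uniq ?divisors_uniq//.
  move=> d; rewrite !mem_filter -!dvdn_divisors// nE.
  have [//|pd/=] := boolP (p %| d)%N.
  by rewrite Gauss_dvdl// coprime_sym prime_coprime.
rewrite -big_filter (perm_big [seq (p * d)%N | d <- divisors m]) /=; last first.
  apply: uniq_perm; rewrite ?filter_uniq ?divisors_uniq//.
    rewrite map_inj_uniq ?divisors_uniq// => a b /eqP.
    by rewrite eqn_pmul2l// => /eqP.
  move=> d; rewrite mem_filter -dvdn_divisors//; apply/andP/mapP.
    case=> /dvdnP[e ->]; rewrite nE dvdn_pmul2r// => em.
    by exists e; rewrite -?dvdn_divisors// mulnC.
  case=> e; rewrite -dvdn_divisors// => em ->; split; first exact: dvdn_mulr.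
  by rewrite nE mulnC dvdn_pmul2r.
rewrite big_map -sumrN [RHS]big_mkcond/= !big_seq; apply: eq_bigr => d.
rewrite -dvdn_divisors// => dm; rewrite moebius_primeM//; last exact: dvdn_gt0 dm.
by case: ifP.
Qed.

(** * Divisor bound *)

Definition tau n := size (divisors n).

(** A divisor [d] of [a * b] factors as [g * (d / g)] with [g = gcd(d, a)]; as [d / g] is coprime to
    [a / g], it divides [b]. *)
Lemma tauM a b : (0 < a)%N -> (0 < b)%N -> (tau (a * b) <= tau a * tau b)%N.
Proof.
move=> a0 b0; rewrite /tau -(size_allpairs (fun x y => (x * y)%N)).
apply: uniq_leq_size; first exact: divisors_uniq.
move=> d; rewrite -dvdn_divisors ?muln_gt0 ?a0// => dab.
have d0 : (0 < d)%N by apply: dvdn_gt0 dab; rewrite muln_gt0 a0.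
have g0 : (0 < gcdn d a)%N by rewrite gcdn_gt0 d0.
apply/allpairsP; exists (gcdn d a, d %/ gcdn d a)%N.
split=> /=; rewrite -?dvdn_divisors ?dvdn_gcdr//; last by rewrite mulnC divnK ?dvdn_gcdl.
have cop : coprime (d %/ gcdn d a) (a %/ gcdn d a).
  rewrite /coprime -(eqn_pmul2r g0) muln_gcdl mul1n.
  by rewrite !divnK ?dvdn_gcdl ?dvdn_gcdr.
rewrite -(Gauss_dvdr _ cop) -(dvdn_pmul2r g0) divnK ?dvdn_gcdl//.
by rewrite mulnAC divnK ?dvdn_gcdr.
Qed.

Lemma tau_pfactor p k : prime p -> (tau (p ^ k) <= k.+1)%N.
Proof.
move=> pp; rewrite /tau -[X in (_ <= X)%N](size_mkseq (fun i => p ^ i)%N).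
apply: uniq_leq_size; first exact: divisors_uniq.
move=> d; rewrite -dvdn_divisors ?expn_gt0 ?prime_gt0// => /(dvdn_pfactor _ _ pp)[m mk ->].
by apply/mapP; exists m => //; rewrite mem_iota.
Qed.

Lemma le_powR2r (R : realType) (e a b : R) :
  0 <= e -> 0 <= a <= b -> a `^ e <= b `^ e.
Proof.
move=> e0 /andP[a0 ab]; apply: ge0_ler_powR => //; rewrite nnegrE//.
exact: le_trans ab.
Qed.

Section DivisorBound.
Variables (R : realType) (eps : R).
Hypothesis eps0 : 0 < eps.

Let rough K n := (0 < n)%N /\ forall p, prime p -> (p %| n)%N -> (K <= p)%N.

(** Each further prime factor at most doubles [tau n] and multiplies [n ^ eps] by at least
    [K ^ eps >= 2]. *)
Lemma tau_rough K : 2 <= K%:R `^ eps ->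
  forall n, rough K n -> (tau n)%:R <= n%:R `^ eps :> R.
Proof.
move=> K2 n; have [m] := ubnP n; elim: m n => // m IH n; rewrite ltnS => nm [n0 Kn].
have [n1|n1] := eqVneq n 1%N; first by rewrite n1 powR1.
have pp : prime (pdiv n) by apply: pdiv_prime; lia.
have pn := pdiv_dvd n; have := Kn _ pp pn; move: (pdiv n) pp pn => p pp /dvdnP[l nE] Kp.
have l0 : (0 < l)%N by move: n0; rewrite nE; case: (l).
have p1 := prime_gt1 pp.
have lm : (l < m)%N.
  by apply: leq_trans nm; rewrite nE -[X in (X < _)%N]muln1 ltn_pmul2l.
have rl : rough K l.
  by split=> // r pr rl; apply: Kn => //; rewrite nE; apply: dvdn_mulr.
have h := IH _ lm rl.
rewrite nE natrM powRM// mulrC.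
apply: (@le_trans _ _ (2%:R * (tau l)%:R)).
  rewrite -natrM ler_nat [(2 * _)%N]mulnC; apply: leq_trans (tauM l0 (prime_gt0 pp)) _.
  by rewrite leq_mul2l; apply/orP; right; rewrite -{1}(expn1 p) (tau_pfactor 1).
rewrite mulrC [leRHS]mulrC ler_pM//.
by apply: le_trans K2 _; rewrite le_powR2r ?ler0n ?ler_nat ?ltW.
Qed.

(* A prime [p] with [p^eps >= 2] costs nothing; each of the finitely many smaller
   ones costs a constant factor. *)
Lemma tau_rough_down K : exists C : R, 0 <= C /\
  forall n, rough K n -> (tau n)%:R <= C * n%:R `^ eps :> R.
Proof.
have [K0 hK0] : exists K0 : nat, 2 <= K0%:R `^ eps.
  exists (Num.truncn (2 `^ (eps^-1) : R)).+1.
  rewrite [leLHS](_ : _ = (2 `^ (eps^-1)) `^ eps); last first.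
    by rewrite -powRrM mulVf ?gt_eqF// powRr1.
  by rewrite le_powR2r ?(ltW eps0)// powR_ge0 ltW// truncnS_gt.
have [KK|/ltnW KK] := leqP K0 K.
  exists 1; split=> // n [n0 hn]; rewrite mul1r; apply: (tau_rough hK0).
  by split=> // p pp pn; apply: leq_trans (hn _ pp pn).
(* Descending induction from [K0]: lowering the threshold from [p + 1] to [p] admits at most one new
   prime, [p] itself. *)
rewrite -(subKn KK); elim: (K0 - K)%N => [|j [C [C0 IH]]].
  exists 1; split=> // n hn; rewrite mul1r; apply: (tau_rough hK0).
  by rewrite subn0 in hn.
have [jK|jK] := leqP K0 j.
  by exists C; split=> // n hn; apply: IH; rewrite (_ : K0 - j = K0 - j.+1)%N//; lia.
set p := (K0 - j.+1)%N; have pE : (K0 - j = p.+1)%N by rewrite /p; lia.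
rewrite pE in IH.
have [pp|pp] := boolP (prime p); last first.
  exists C; split=> // n [n0 hn]; apply: IH; split=> // r pr rn.
  by rewrite ltn_neqAle hn// andbT; apply: contraNneq pp => ->.
have ln2 : 0 < eps * ln 2 by rewrite mulr_gt0// ln_gt0// ltr1n.
(* With [a = eps * ln 2], [p ^ (k eps) >= exp (k a) >= 1 + k a], and [k + 1 <= (1 + 1/a) (1 + k a)];
   so the factor [1 + 1/a] absorbs the [k + 1] divisors of [p ^ k]. *)
exists ((1 + (eps * ln 2)^-1) * C); split.
  by rewrite mulr_ge0// addr_ge0// invr_ge0 ltW.
move=> n [n0 hn].
have [m cop nE] := pfactor_coprime pp n0; set k := logn p n in nE.
have m0 : (0 < m)%N by move: n0; rewrite nE; case: (m).
have rm : rough p.+1 m.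
  split=> // r pr rm; rewrite ltn_neqAle hn// ?andbT; last by rewrite nE dvdn_mulr.
  by apply: contraTneq cop => ->; rewrite prime_coprime// rm.
have pk0 : (0 < p ^ k)%N by rewrite expn_gt0 prime_gt0.
rewrite nE natrM powRM//.
apply: (@le_trans _ _ ((tau m)%:R * k.+1%:R)).
  rewrite -natrM ler_nat; apply: leq_trans (tauM m0 pk0) _.
  by rewrite leq_mul2l tau_pfactor ?orbT.
have hk : k.+1%:R <= (1 + (eps * ln 2)^-1) * (p ^ k)%:R `^ eps :> R.
  have h2 : 1 + k%:R * (eps * ln 2) <= (p ^ k)%:R `^ eps :> R.
    apply: (@le_trans _ _ ((2 ^ k)%:R `^ eps)); last first.
      by rewrite le_powR2r ?ler0n ?ler_nat ?(ltW eps0)//; case: (k) => // i; rewrite leq_exp2r ?prime_gt1.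
    rewrite natrX -powR_mulrn// -powRrM /powR gt_eqF// .
    rewrite (_ : k%:R * (eps * ln 2) = k%:R * eps * ln 2) ?mulrA//.
    exact: expR_ge1Dx.
  rewrite -natr1; set a := eps * ln 2 in ln2 h2 *.
  apply: (@le_trans _ _ ((1 + a^-1) * (1 + k%:R * a))).
    have -> : (1 + a^-1) * (1 + k%:R * a) = 1 + k%:R * a + a^-1 + k%:R.
      by field; rewrite gt_eqF.
    have : 0 <= k%:R * a by rewrite mulr_ge0// ltW.
    have : 0 <= a^-1 by rewrite invr_ge0 ltW.
    by lra.
  by rewrite ler_wpM2l// addr_ge0// invr_ge0 ltW.
apply: (@le_trans _ _ ((C * m%:R `^ eps) * ((1 + (eps * ln 2)^-1) * (p ^ k)%:R `^ eps))).
  by apply: ler_pM => //; exact: IH.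
by rewrite le_eqVlt; apply/orP; left; apply/eqP; ring.
Qed.

Lemma tau_bound : exists C : R, 0 <= C /\
  forall n, (0 < n)%N -> (tau n)%:R <= C * n%:R `^ eps :> R.
Proof.
have [C [C0 h]] := tau_rough_down 0; exists C; split=> // n n0.
by apply: h; split.
Qed.

End DivisorBound.

(** * Exponential sums *)

Section ExpSums.
Variable R : realType.
Implicit Types (s t y : R) (z : R[i]).

(** The norm on [R[i]] has values in [R[i]], whose order is only partial; the real part allows
    estimates in [R]. *)
Definition cabs z : R := complex.Re `|z|.

Lemma cabsE z : `|z| = (cabs z)%:C.
Proof. by rewrite /cabs normc_def. Qed.

Lemma cabs_ge0 z : 0 <= cabs z.
Proof. by rewrite -lecR -cabsE normr_ge0. Qed.

Lemma cabsM z1 z2 : cabs (z1 * z2) = cabs z1 * cabs z2.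
Proof. by apply: (@complexI R); rewrite rmorphM/= -!cabsE normrM. Qed.

Lemma cabs_sum (I : Type) (r : seq I) (P : pred I) (F : I -> R[i]) :
  cabs (\sum_(i <- r | P i) F i) <= \sum_(i <- r | P i) cabs (F i).
Proof.
rewrite -lecR -cabsE rmorph_sum/=.
by rewrite (le_trans (ler_norm_sum _ _ _))// ler_sum// => i _; rewrite cabsE.
Qed.

Lemma cabsD z1 z2 : cabs (z1 + z2) <= cabs z1 + cabs z2.
Proof. by rewrite -lecR -cabsE rmorphD/= -!cabsE ler_normD. Qed.

Lemma cabsN z : cabs (- z) = cabs z.
Proof. by rewrite /cabs normrN. Qed.

Lemma cabs_real (x : R) : cabs x%:C = `|x|.
Proof. by rewrite /cabs normc_def/= expr0n/= addr0 sqrtr_sqr. Qed.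

Lemma cabs_int (k : int) : cabs k%:~R = `|k|%:~R.
Proof.
have -> : k%:~R = (k%:~R : R)%:C by rewrite rmorph_int.
by rewrite cabs_real intr_norm.
Qed.

Lemma cabs_sqr z : (cabs z ^+ 2)%:C = z * z^*%C.
Proof. by rewrite rmorphXn/= -cabsE sqr_normc. Qed.

Lemma expi2piD s t : expi2pi (s + t) = expi2pi s * expi2pi t.
Proof.
rewrite /expi2pi mulrDr cosD sinD; apply/eqP; rewrite eq_complex /=.
by apply/andP; split; apply/eqP; ring.
Qed.

Lemma expi2pi0 : expi2pi 0 = 1 :> R[i].
Proof. by rewrite /expi2pi mulr0 cos0 sin0. Qed.

Lemma expi2piN t : expi2pi (- t) = (expi2pi t)^*%C.
Proof. by rewrite /expi2pi mulrN cosN sinN. Qed.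

Lemma expi2pi_nat t k : expi2pi (t * k%:R) = expi2pi t ^+ k.
Proof.
elim: k => [|k IH]; first by rewrite mulr0 expi2pi0 expr0.
by rewrite -natr1 mulrDr mulr1 expi2piD IH exprSr.
Qed.

Lemma cabs_expi2pi t : cabs (expi2pi t) = 1.
Proof. by rewrite /cabs normc_def/= cos2Dsin2 sqrtr1. Qed.

Lemma expi2pi_int (k : int) : expi2pi k%:~R = 1 :> R[i].
Proof.
have nat1 (n : nat) : expi2pi n%:R = 1 :> R[i].
  rewrite -(mul1r n%:R) expi2pi_nat (_ : expi2pi 1 = 1) ?expr1n//.
  by rewrite /expi2pi mulr1 mulrC mulr_natr cos2pi sin2pi.
case: k => n; first exact: nat1.
by rewrite NegzE mulrNz expi2piN nat1 conjc1.
Qed.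

Lemma cabs_1Bexpi2pi t : cabs (1 - expi2pi t) = 2 * `|sin (pi * t)|.
Proof.
rewrite -[2]ger0_norm// -normrM -sqrtr_sqr /cabs normc_def /=; congr Num.sqrt.
have -> : 2 * pi * t = (pi * t) *+ 2 by rewrite -mulrA mulr_natl.
rewrite cos_mulr2n sin_mulr2n; have := cos2Dsin2 (pi * t).
set c := cos _; set s := sin _ => h.
have hc : c ^+ 2 = 1 - s ^+ 2 by rewrite -h addrK.
rewrite -[c ^+ 2 *+ 2]mulr_natl -[(c * s) *+ 2]mulr_natl.
rewrite sub0r sqrrN !exprMn hc.
by ring.
Qed.

(** Up to [pi / 4] the mean value theorem gives slope at least [1/2], since [cos (2 c) >= 0] forces
    [cos c >= 1/2]. Beyond that, monotonicity gives [sin t >= sin (pi / 4) >= pi / 8 >= t / 4]. *)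
Lemma sin_ge_quarter t : 0 <= t <= @pi R / 2 -> t / 4 <= sin t.
Proof.
have half (u : R) : 0 <= u <= @pi R / 4 -> u / 2 <= sin u.
  move=> /andP[u0 u4].
  have Dsin x : x \in `]0, u[%R -> is_derive x 1 (@sin R) (cos x) by move=> _; exact: is_derive_sin.
  have Csin : {within `[0, u], continuous (@sin R)}.
    by apply: continuous_subspaceT => x; exact: continuous_sin.
  have [c] := MVT_segment u0 Dsin Csin.
  rewrite in_itv/= => /andP[c0 cu]; rewrite sin0 !subr0 => ->.
  rewrite mulrC ler_wpM2r//.
  have cge0 : 0 <= cos c.
    by apply: cos_ge0_pihalf; have := pi_gt0 R; lra.
  have : 0 <= cos (c *+ 2).
    by apply: cos_ge0_pihalf; rewrite -mulr_natr; have := pi_gt0 R; lra.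
  rewrite cos_mulr2n -mulr_natr; nra.
move=> /andP[t0 tp]; have [t4|t4] := leP t (pi / 4).
  by apply: le_trans (half t _); rewrite ?t0//; lra.
have p0 := pi_gt0 R.
apply: (@le_trans _ _ (sin (pi / 4))).
  by apply: le_trans (half (pi / 4) _); [lra|apply/andP; split; lra].
by apply: ltW; rewrite ltr_sin// in_itv/=; lra.
Qed.

Lemma norm_sin_intD (k : int) y : `|sin (pi * (k%:~R + y))| = `|sin (pi * y)|.
Proof.
have h : 2 * `|sin (pi * (k%:~R + y))| = 2 * `|sin (pi * y)|.
  by rewrite -!cabs_1Bexpi2pi expi2piD expi2pi_int mul1r.
by move: h => /mulfI; apply; rewrite pnatr_eq0.
Qed.

(** The sum of two reciprocals stands in for the reciprocal distance of [y] to the nearest integer: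
    each term can be summed over residues on its own, with no case distinction. *)
Lemma inv_sin_le (k : int) y : 0 < y < 1 ->
  `|sin (pi * (k%:~R + y))|^-1 <= 2 / y + 2 / (1 - y).
Proof.
move=> /andP[y0 y1]; rewrite norm_sin_intD.
have p2 := @pi_ge2 R.
have main (x : R) : 0 < x <= 2^-1 -> `|sin (pi * x)|^-1 <= 2 / x.
  move=> /andP[x0 x2].
  have h : x / 2 <= sin (pi * x).
    apply: le_trans (@sin_ge_quarter (pi * x) _); first nra.
    by apply/andP; split; nra.
  rewrite -[2 / x]invrK invf_div ler_pV2 ?inE ?unitfE ?gt_eqF ?divr_gt0//=.
  - by apply: le_trans (ler_norm _).
  - by rewrite normr_gt0 gt_eqF// (lt_le_trans _ h)// divr_gt0.
  - by rewrite normr_gt0 gt_eqF// (lt_le_trans _ h)// divr_gt0.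
have [y2|/ltW y2] := leP y 2^-1.
  rewrite (le_trans (main y _)) ?y0// lerDl divr_ge0// subr_ge0 ltW//.
rewrite (_ : sin (pi * y) = sin (pi * (1 - y))).
  rewrite (le_trans (main (1 - y) _)) ?lerDr ?divr_ge0// ?(ltW y0)//.
  by apply/andP; split; lra.
by rewrite mulrBr mulr1 sinB sinpi cospi mul0r sub0r mulN1r opprK.
Qed.

(** * Geometric sums *)

Lemma geometric_sum_le_card t a b :
  cabs (\sum_(a <= k < b) expi2pi (t * k%:R)) <= (b - a)%:R.
Proof.
rewrite (le_trans (cabs_sum _ _ _))// (eq_bigr (fun=> 1)); last first.
  by move=> k _; rewrite cabs_expi2pi.
by rewrite sumr_const_nat.
Qed.

Lemma geometric_sum_le_sin t a b : sin (pi * t) != 0 ->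
  cabs (\sum_(a <= k < b) expi2pi (t * k%:R)) <= `|sin (pi * t)|^-1.
Proof.
move=> st; set S := \sum_(_ <= _ < _) _.
have [ba|/ltnW ab] := leqP b a.
  rewrite /S big_geq// /cabs normr0 invr_ge0//.
have tel : (expi2pi t - 1) * S = expi2pi t ^+ b - expi2pi t ^+ a.
  rewrite /S mulr_sumr -(telescope_sumr (fun k => expi2pi t ^+ k) ab).
  by apply: eq_bigr => k _; rewrite expi2pi_nat exprS mulrBl mul1r.
have : cabs ((expi2pi t - 1) * S) <= 2.
  rewrite tel (le_trans (cabsD _ _))// cabsN -!expi2pi_nat !cabs_expi2pi.
  by rewrite -[2]/(1 + 1).
rewrite cabsM -cabsN opprB cabs_1Bexpi2pi -mulrA ger_pMr// => h.
by rewrite -[leRHS]mul1r ler_pdivlMr ?normr_gt0// mulrC.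
Qed.

(* Writing [k] as the number of [j] with [1 <= j <= k] turns the weighted sum
   into [b] unweighted ones. *)
Lemma weighted_geometric_sum_le t (M : R) a b :
    (forall a', (0 < a')%N ->
       cabs (\sum_(a' <= k < b.+1) expi2pi (t * k%:R)) <= M) ->
  cabs (\sum_(a <= k < b.+1) k%:R * expi2pi (t * k%:R)) <= b%:R * M.
Proof.
move=> hM.
have -> : \sum_(a <= k < b.+1) k%:R * expi2pi (t * k%:R) =
    \sum_(0 <= j < b) \sum_(maxn a j.+1 <= k < b.+1) expi2pi (t * k%:R).
  transitivity (\sum_(a <= k < b.+1) \sum_(0 <= j < b)
      if (j < k)%N then expi2pi (t * k%:R) else 0).
    rewrite !big_nat; apply: eq_bigr => k /andP[_ kb].
    rewrite (big_cat_nat (n := k)) //=.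
    rewrite [X in _ + X]big_nat [X in _ + X]big1 ?addr0; last first.
      by move=> j /andP[kj _]; rewrite ltnNge kj.
    rewrite big_nat (eq_bigr (fun=> expi2pi (t * k%:R))); last by move=> j /andP[_ ->].
    by rewrite -big_nat sumr_const_nat subn0 mulr_natl.
  rewrite exchange_big/= !big_nat; apply: eq_bigr => j /andP[_ jb].
  have [ab|ba] := leqP (maxn a j.+1) b.+1; last first.
    rewrite [RHS]big_geq; last exact: ltnW.
    by rewrite big_nat big1// => k hk; case: ifP => //; lia.
  rewrite (big_cat_nat (n := maxn a j.+1))//=; last lia.
  rewrite big_nat big1 ?add0r; last by move=> k hk; case: ifP => //; lia.
  by rewrite !big_nat; apply: eq_bigr => k hk; case: ifP => //; lia.
rewrite (le_trans (cabs_sum _ _ _))//.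
apply: (@le_trans _ _ (\sum_(0 <= j < b) M)).
  by apply: ler_sum => j _; apply: hM; lia.
by rewrite sumr_const_nat subn0 mulr_natl.
Qed.

End ExpSums.

(** * Sums of [min(N / h, 1 / |sin (pi alpha h)|)] *)

Section Harmonic.
Variable R : realType.

Definition harm n : R := \sum_(1 <= k < n.+1) k%:R^-1.

Lemma harm_recl n : harm n = \sum_(0 <= k < n.+1) k%:R^-1.
Proof. by rewrite [RHS]big_nat_recl// invr0 add0r /harm big_add1. Qed.

Lemma sumr_nat_widen (F : nat -> R) m n p : (forall k, 0 <= F k) -> (n <= p)%N ->
  \sum_(m <= k < n) F k <= \sum_(m <= k < p) F k.
Proof.
move=> F0 np; have [mn|nm] := leqP m n; last first.
  by rewrite big_geq ?(ltnW nm)// sumr_ge0.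
by rewrite [leRHS](big_cat_nat (n := n))//= lerDl sumr_ge0.
Qed.

Lemma le_harm m n : (m <= n)%N -> harm m <= harm n.
Proof. by move=> mn; apply: sumr_nat_widen. Qed.

Lemma harm_ge1 n : (0 < n)%N -> 1 <= harm n.
Proof.
by move=> n0; apply: le_trans (le_harm n0); rewrite /harm big_nat1 invr1.
Qed.

Lemma harm_le_ln n : (0 < n)%N -> harm n <= 1 + ln n%:R.
Proof.
case: n => // n _; elim: n => [|n IH].
  by rewrite /harm big_nat1 invr1 ln1 addr0.
rewrite /harm big_nat_recr//=.
have h : (n.+2%:R)^-1 <= ln n.+2%:R - ln n.+1%:R :> R.
  rewrite -lerN2 opprB -ln_div ?posrE//.
  rewrite [X in ln X](_ : _ = 1 + - (n.+2%:R)^-1); last first.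
    have x0 : 0 < n.+1%:R :> R by [].
    rewrite -(natr1 n.+1); move: (n.+1%:R) x0 => x x0; field.
    by rewrite gt_eqF// addr_gt0.
  by apply: le_ln1Dx; rewrite ltrN2 invf_lt1// ltr1n.
by apply: le_trans (lerD IH h) _; rewrite addrA addrAC addrK.
Qed.

Lemma harm_bound (eps : R) : 0 < eps -> exists C : R, 0 <= C /\
  forall n, (0 < n)%N -> harm n <= C * n%:R `^ eps.
Proof.
move=> e0; exists (1 + eps^-1); split; first by rewrite addr_ge0// invr_ge0 ltW.
move=> n n0; apply: le_trans (harm_le_ln n0) _.
have n1 : 1 <= n%:R :> R by rewrite ler1n.
have p1 : 1 <= n%:R `^ eps by rewrite -[leLHS](powRr0 n%:R) ler_powR// ltW.
rewrite mulrDl mul1r lerD//.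
rewrite mulrC ler_pdivlMr// mulrC -ln_powR ltW// ln_sublinear// .
exact: lt_le_trans p1.
Qed.

End Harmonic.

Section MinSum.
Variables (R : realType) (alpha : R).

Definition isin h : R := `|sin (pi * (alpha * h%:R))|^-1.

(* Both arguments of the minimum vanish at [h = 0], as [x / 0 = 0]. *)
Definition minw (N h : nat) : R := Num.min (N%:R / h%:R) (isin h).

Lemma isin_ge0 h : 0 <= isin h.
Proof. by rewrite invr_ge0. Qed.

Lemma minw_ge0 N h : 0 <= minw N h.
Proof. by rewrite le_min divr_ge0// isin_ge0. Qed.

Variables (a : int) (q : nat).
Hypotheses (q0 : (0 < q)%N) (coaq : coprime `|a| q)
  (approx : `|q%:R * alpha - a%:~R| <= q%:R^-1).

Let qR0 : 0 < q%:R :> R. Proof. by rewrite ltr0n. Qed.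

Definition residue (k : int) (r : nat) : nat := `|((k + a * r%:Z) %% q%:Z)%Z|%N.

Lemma residueE k r : (residue k r)%:Z = ((k + a * r%:Z) %% q%:Z)%Z.
Proof. by rewrite /residue gez0_abs// modz_ge0//; lia. Qed.

Lemma residue_lt k r : (residue k r < q)%N.
Proof. by rewrite -ltz_nat residueE ltz_pmod. Qed.

Lemma residue_eq k r r' : residue k r = residue k r' -> (r = r' %[mod q])%N.
Proof.
move=> h; have : ((k + a * r%:Z) == (k + a * r'%:Z) %[mod q%:Z])%Z.
  by rewrite -!residueE h.
rewrite eqz_mod_dvd (_ : _ - _ = a * (r%:Z - r'%:Z)); last by ring.
rewrite Gauss_dvdzr; last by rewrite coprimezE coprime_sym.
by rewrite -eqz_mod_dvd !modz_nat => /eqP[].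
Qed.

Lemma residue_inj k : injective (fun r : 'I_q => Ordinal (residue_lt k r)).
Proof.
move=> r r' [] /residue_eq; rewrite !modn_small// => h.
exact: val_inj.
Qed.

Lemma sum_residue k (G : nat -> R) :
  \sum_(0 <= r < q) G (residue k r) = \sum_(0 <= s < q) G s.
Proof.
by rewrite !big_mkord [RHS](reindex_inj (@residue_inj k)).
Qed.

(** Modulo 1, [alpha * h] equals [(s + xi) / q] with [s] the residue; [lo] and [hi] bound from below
    the distances of [s + xi] to [0] and to [q]. *)
Lemma isin_le_residue (k : int) (xi lo hi : R) r h :
    alpha * h%:R = (k%:~R + a%:~R * r%:R + xi) / q%:R ->
    0 < lo -> 0 < hi -> lo <= (residue k r)%:R + xi ->
    (residue k r)%:R + xi <= q%:R - hi ->
  isin h <= 2 * q%:R / lo + 2 * q%:R / hi.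
Proof.
move=> hE lo0 hi0 hlo hhi; set s := (residue k r)%:R in hlo hhi.
set y := (s + xi) / q%:R.
have -> : isin h = `|sin (pi * (((k + a * r%:Z) %/ q%:Z)%Z%:~R + y))|^-1.
  rewrite /isin hE /y; congr (`|sin (pi * _)|^-1).
  have := divz_eq (k + a * r%:Z) q%:Z; rewrite -residueE => /(congr1 (fun z : int => z%:~R : R)).
  rewrite !intrD !intrM -!pmulrn => ->; rewrite -/s.
  by field; rewrite gt_eqF.
have y0 : lo / q%:R <= y by rewrite ler_pM2r// invr_gt0.
have y1 : hi / q%:R <= 1 - y.
  rewrite /y ler_pdivrMr// mulrBl divfK ?gt_eqF// mul1r; lra.
have l0 : 0 < lo / q%:R by rewrite divr_gt0.
have h0 : 0 < hi / q%:R by rewrite divr_gt0.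
apply: le_trans (inv_sin_le _ _) _; first by apply/andP; split; lra.
rewrite lerD// -mulrA ler_pM2l//.
  by rewrite -invf_div lef_pV2 ?posrE//; lra.
by rewrite -invf_div lef_pV2 ?posrE//; lra.
Qed.

Lemma sum_lt2 n : \sum_(0 <= s < n) ((s < 2)%N%:R : R) <= 2.
Proof.
case: n => [|[|n]]; [by rewrite big_geq|by rewrite big_nat1 ler1n|].
rewrite !big_nat_recl//= big1// addr0.
by rewrite -[2]/(1 + 1).
Qed.

(* [alpha (h0 + r) = n + (s + xi) / q] with [n] an integer and [-1 < xi < 2], where
   [s] runs once over the residues modulo [q] as [r] does. *)
Lemma isin_block_sum (B : R) h0 : 0 <= B ->
  \sum_(0 <= r < q) Num.min B (isin (h0 + r)) <= 4 * B + 4 * q%:R * harm R q.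
Proof.
move=> B0; pose k := Num.floor (q%:R * (alpha * h0%:R)).
(* Given the range of [xi], [s + xi] can come too close to [0] or [q] only for the two lowest and
   the two highest residues, which are charged [B] each. For the others the two distances are at
   least [s - 1] and [q - s - 2]. *)
pose G s : R := B * (s < 2)%N%:R + B * (q - s.+1 < 2)%N%:R
  + 2 * q%:R * (s.-1)%:R^-1 + 2 * q%:R * ((q - s.+1).-1)%:R^-1.
have G3 s : 0 <= 2 * q%:R * (s.-1)%:R^-1 :> R by rewrite mulr_ge0// ?invr_ge0// mulr_ge0.
apply: (@le_trans _ _ (\sum_(0 <= r < q) G (residue k r))).
  rewrite !big_nat ler_sum// => r /andP[_ rq].
  rewrite /G; have sq := residue_lt k r.
  have [s2|s2] := ltnP (residue k r) 2.
    by rewrite mulr1 -!addrA ge_min lerDl !addr_ge0// mulr_ge0.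
  have [s3|s3] := ltnP (q - (residue k r).+1) 2.
    by rewrite mulr0 mulr1 add0r -!addrA ge_min lerDl !addr_ge0.
  rewrite !mulr0 add0r add0r ge_min; apply/orP; right.
  pose xi := q%:R * (alpha * h0%:R) - k%:~R + r%:R * (q%:R * alpha - a%:~R).
  have xr : `|r%:R * (q%:R * alpha - a%:~R)| <= 1.
    rewrite normrM ger0_norm// (@le_trans _ _ (q%:R * q%:R^-1))//.
      by rewrite ler_pM// ler_nat ltnW.
    by rewrite divff// gt_eqF.
  have f1 : k%:~R <= q%:R * (alpha * h0%:R) by exact: floor_le.
  have f2 : q%:R * (alpha * h0%:R) < k%:~R + 1 by have := floorD1_gt (q%:R * (alpha * h0%:R)); rewrite intrD.
  move: xr; rewrite ler_norml => /andP[x1 x2].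
  have sR : (residue k r)%:R = (residue k r).-1%:R + 1 :> R.
    by rewrite natr1 prednK//; lia.
  have qsR : q%:R = (residue k r)%:R + 2 + (q - (residue k r).+1).-1%:R :> R.
    by rewrite -!natrD; congr (_%:R); lia.
  apply: (@isin_le_residue k xi _ _ r).
  - by rewrite /xi natrD; field; rewrite gt_eqF.
  - by rewrite ltr0n; lia.
  - by rewrite ltr0n; lia.
  - by rewrite /xi; lra.
  - by rewrite /xi; lra.
rewrite sum_residue /G !big_split/= -!mulr_sumr.
have s1 := sum_lt2 q.
have rev (F : nat -> R) : \sum_(0 <= s < q) F (q - s.+1)%N = \sum_(0 <= s < q) F s.
  by rewrite [RHS]big_nat_rev/= add0n.
have h1 : \sum_(0 <= s < q) (s.-1)%:R^-1 <= harm R q.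
  rewrite -(prednK q0) big_nat_recl//= invr0 add0r harm_recl.
  by apply: sumr_nat_widen => //; lia.
rewrite (rev (fun s => (s < 2)%N%:R)) (rev (fun s => (s.-1)%:R^-1)).
have : B * \sum_(0 <= s < q) ((s < 2)%N%:R : R) <= B * 2 by rewrite ler_wpM2l.
have : 2 * q%:R * (\sum_(0 <= s < q) (s.-1)%:R^-1) <= 2 * q%:R * harm R q :> R.
  by rewrite ler_wpM2l// mulr_ge0.
by lra.
Qed.

(** For [h] near [0] the cap [N / h] is too large to help. But for [0 < r <= q / 2] the perturbation
    [xi] is at most [1/2] in absolute value and the residue [s] of [a * r] is nonzero by
    coprimality, so [s + xi] keeps distance at least [s / 2] from [0] and [(q - s) / 2] from [q]. *)
Lemma isin_small_sum :
  \sum_(0 <= r < q) (if (0 < r)%N && (r.*2 <= q)%N then isin r else 0)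
    <= 8 * q%:R * harm R q.
Proof.
pose G s : R := 4 * q%:R * s%:R^-1 + 4 * q%:R * ((q - s.+1).+1)%:R^-1.
apply: (@le_trans _ _ (\sum_(0 <= r < q) G (residue 0 r))).
  rewrite !big_nat ler_sum// => r /andP[_ rq].
  have sq := residue_lt 0 r.
  case: ifP => [/andP[r0 r2]|_]; last first.
    by rewrite /G addr_ge0// mulr_ge0 ?invr_ge0// mulr_ge0.
  have s0 : (0 < residue 0 r)%N.
    rewrite lt0n; apply/eqP => s0.
    have /residue_eq : residue 0 r = residue 0 0 by rewrite s0 /residue mulr0 addr0 mod0z.
    by rewrite !modn_small//; lia.
  pose xi := r%:R * (q%:R * alpha - a%:~R).
  have xr : `|xi| <= 2^-1.
    rewrite normrM ger0_norm// (@le_trans _ _ (r%:R * q%:R^-1))//.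
      by rewrite ler_wpM2l.
    by rewrite ler_pdivrMr// mulrC ler_pdivlMr// -natrM ler_nat; lia.
  move: xr; rewrite ler_norml => /andP[x1 x2].
  have s1 : 1 <= (residue 0 r)%:R :> R by rewrite ler1n.
  have qsR : q%:R = (residue 0 r)%:R + (q - (residue 0 r).+1).+1%:R :> R.
    by rewrite -!natrD; congr (_%:R); lia.
  have t1 : 1 <= (q - (residue 0 r).+1).+1%:R :> R by rewrite ler1n.
  apply: le_trans (@isin_le_residue 0 xi ((residue 0 r)%:R / 2)
     ((q - (residue 0 r).+1).+1%:R / 2) r r _ _ _ _ _) _.
  - by rewrite /xi add0r; field; rewrite gt_eqF.
  - by lra.
  - by lra.
  - by lra.
  - by lra.
  - rewrite /G !invf_div !mulrA; rewrite le_eqVlt; apply/orP; left; apply/eqP.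
    by field; rewrite !gt_eqF//; lra.
rewrite sum_residue /G !big_split/= -!mulr_sumr.
have rev (F : nat -> R) : \sum_(0 <= s < q) F (q - s.+1)%N = \sum_(0 <= s < q) F s.
  by rewrite [RHS]big_nat_rev/= add0n.
rewrite (rev (fun s => s.+1%:R^-1)).
have h1 : \sum_(0 <= s < q) s%:R^-1 <= harm R q.
  by rewrite harm_recl; apply: sumr_nat_widen.
have h2 : \sum_(0 <= s < q) s.+1%:R^-1 = harm R q by rewrite /harm big_add1.
rewrite h2.
have : 4 * q%:R * (\sum_(0 <= s < q) s%:R^-1) <= 4 * q%:R * harm R q :> R.
  by rewrite ler_wpM2l// mulr_ge0.
by lra.
Qed.

(** The range is cut into blocks of length [q]. On the block starting at [j q], [j >= 1], the cap is
    at most [N / (j q)]: the caps sum to a harmonic sum times [N / q], and the sine terms cost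
    [q log N] on each of at most [H / q] blocks. The block at [0] is split at [q / 2]. *)
Lemma minw_sum N H : (q <= N)%N -> (H <= N)%N ->
  \sum_(1 <= h < H.+1) minw N h <= 12 * harm R N * (N%:R / q%:R + q%:R + H%:R).
Proof.
move=> qN HN.
have L1 : 1 <= harm R N by apply: harm_ge1; apply: leq_trans qN.
have Lq : harm R q <= harm R N by apply: le_harm.
set L := harm R N in L1 Lq *; set J := (H %/ q)%N.
have Nq0 : 0 <= N%:R / q%:R :> R by rewrite divr_ge0.
have bl (B : R) h0 : 0 <= B ->
    \sum_(0 <= r < q) Num.min B (isin (h0 + r)) <= 4 * B + 4 * q%:R * L.
  move=> B0; apply: le_trans (isin_block_sum h0 B0) _.
  by rewrite lerD2l ler_wpM2l// mulr_ge0.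
apply: (@le_trans _ _ (\sum_(0 <= h < J.+1 * q) minw N h)).
  apply: (@le_trans _ _ (\sum_(0 <= h < H.+1) minw N h)).
    by rewrite [leRHS]big_nat_recl// big_add1/= lerDr minw_ge0.
  by apply: sumr_nat_widen; [exact: minw_ge0|rewrite /J ltn_ceil].
rewrite big_nat_mul/= big_nat_recl// mul0n mul1n.
have hb0 : \sum_(0 <= r < q) minw N r <= 8 * (N%:R / q%:R) + 12 * q%:R * L.
  (* Below [q / 2] only the sine is used; above it [N / r <= 2 N / q] serves as a uniform cap. *)
  apply: (@le_trans _ _ (\sum_(0 <= r < q)
     ((if (0 < r)%N && (r.*2 <= q)%N then isin r else 0)
       + Num.min (2 * (N%:R / q%:R)) (isin (0 + r))))).
    apply: ler_sum => r _; rewrite add0n.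
    have m0 : 0 <= Num.min (2 * (N%:R / q%:R)) (isin r).
      by rewrite le_min isin_ge0 mulr_ge0.
    case: ifP => h.
      by apply: (@le_trans _ _ (isin r)); rewrite ?lerDl// ge_min lexx orbT.
    rewrite add0r; case: r h m0 => [|r] h m0.
      by apply: le_trans m0; rewrite ge_min invr0 mulr0 lexx.
    have {}h : (q < r.+1.*2)%N by move: h; rewrite /= ltnNge => ->.
    rewrite le_min ge_min /minw ge_min lexx orbT andbT; apply/orP; left.
    rewrite mulrCA ler_wpM2l// -invf_div lef_pV2 ?posrE ?divr_gt0//.
    by rewrite ler_pdivrMr// -natrM ler_nat; lia.
  rewrite big_split/=.
  have B0 : 0 <= 2 * (N%:R / q%:R) :> R by rewrite mulr_ge0.
  have := bl _ 0%N B0; have := isin_small_sum.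
  have : 8 * q%:R * harm R q <= 8 * q%:R * L by rewrite ler_wpM2l// mulr_ge0.
  by lra.
have hb1 j : \sum_(j.+1 * q <= h < j.+2 * q) minw N h
    <= 4 * (N%:R / q%:R) * j.+1%:R^-1 + 4 * q%:R * L.
  rewrite -{1}[(j.+1 * q)%N]add0n big_addn (_ : j.+2 * q - j.+1 * q = q)%N; last lia.
  have B0 : 0 <= N%:R / (j.+1 * q)%:R :> R by rewrite divr_ge0.
  apply: (@le_trans _ _ (\sum_(0 <= r < q)
      Num.min (N%:R / (j.+1 * q)%:R) (isin (j.+1 * q + r)))).
    apply: ler_sum => r _; rewrite addnC /minw le_min !ge_min lexx orbT andbT.
    apply/orP; left; rewrite ler_wpM2l// lef_pV2 ?posrE ?ltr0n ?ler_nat//.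
    - by rewrite leq_addr.
    - by rewrite addn_gt0 muln_gt0 q0.
    - by rewrite muln_gt0 q0.
  apply: le_trans (bl _ _ B0) _.
  by rewrite natrM invfM !mulrA lerD2r// le_eqVlt; apply/orP; left; apply/eqP; ring.
have hb : \sum_(0 <= j < J) \sum_(j.+1 * q <= h < j.+2 * q) minw N h
    <= 4 * (N%:R / q%:R) * L + 4 * L * H%:R.
  apply: le_trans (ler_sum _ (fun j _ => hb1 j)) _.
  rewrite big_split/= -mulr_sumr sumr_const_nat subn0 lerD//.
    rewrite ler_wpM2l ?mulr_ge0//.
    rewrite (_ : \sum_(0 <= i < J) i.+1%:R^-1 = harm R J); last by rewrite /harm big_add1.
    by apply: le_harm; apply: leq_trans HN; rewrite leq_div.
  rewrite -[leLHS]mulr_natr (_ : 4 * q%:R * L * J%:R = 4 * L * (J * q)%:R); last by rewrite natrM; ring.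
  by rewrite ler_wpM2l ?mulr_ge0 ?(le_trans _ L1)// ler_nat leq_trunc_div.
have : 8 * (N%:R / q%:R) * 1 <= 8 * (N%:R / q%:R) * L by rewrite ler_wpM2l// mulr_ge0.
have : 0 <= L * H%:R by rewrite mulr_ge0// (le_trans _ L1).
have -> : 12 * L * (N%:R / q%:R + q%:R + H%:R) =
   12 * (N%:R / q%:R) * L + 12 * q%:R * L + 12 * (L * H%:R) by ring.
by move: hb hb0; lra.
Qed.

End MinSum.

(** * Vaughan's identity *)

Section Vaughan.
Variables (A : comNzRingType) (N : nat) (f mu mu1 mu2 c : nat -> A).
Hypothesis mu_inv : forall n, (0 < n <= N)%N ->
  \sum_(1 <= d < N.+1 | (d %| n)%N) mu d = (n == 1%N)%:R.
Hypothesis muD : forall n, mu n = mu1 n + mu2 n.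
Hypothesis cE : forall m,
  c m = (m == 1%N)%:R - \sum_(1 <= d < N.+1 | (d %| m)%N) mu1 d.

Lemma sum_multiples d (P : pred nat) (g : nat -> A) : (0 < d)%N ->
  \sum_(1 <= m < N.+1 | (d %| m)%N && P m) g m =
  \sum_(1 <= l < N.+1 | (d * l <= N)%N && P (d * l)%N) g (d * l)%N.
Proof.
move=> d0; rewrite -big_filter -[RHS]big_filter -(big_map (muln d) predT g).
apply: perm_big; apply: uniq_perm.
- by rewrite filter_uniq// iota_uniq.
- rewrite map_inj_uniq ?filter_uniq ?iota_uniq// => x y /eqP.
  by rewrite eqn_pmul2l// => /eqP.
move=> m; rewrite mem_filter mem_index_iota; apply/idP/mapP.
  case/andP=> /andP[/dvdnP[l ->] Pl] lN; exists l; last by rewrite mulnC.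
  by rewrite mem_filter mem_index_iota [(d * l)%N]mulnC Pl; nia.
case=> l; rewrite mem_filter mem_index_iota => /andP[/andP[dl Pl] lN] ->.
by rewrite dvdn_mulr// Pl; nia.
Qed.

Lemma sum_eq1 (g : nat -> A) :
  \sum_(1 <= m < N.+1) (m == 1%N)%:R * g m = if (0 < N)%N then g 1%N else 0.
Proof.
case: ltnP => N0; last by rewrite big_geq.
rewrite big_ltn// mul1r big_nat big1 ?addr0// => m /andP[m1 _].
by rewrite gtn_eqF// mul0r.
Qed.

Let X k d : A := \sum_(1 <= l < N.+1 | (k * d * l <= N)%N) f (k * d * l)%N.

(** Grouping by [n = k * l] produces the divisor sum of [mu] over [n], so only [n = 1] survives. *)
Lemma hyperbola_moebius d : (0 < d <= N)%N ->
  \sum_(1 <= k < N.+1) mu k * X k d = f d.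
Proof.
move=> /andP[d0 dN].
transitivity (\sum_(1 <= k < N.+1) \sum_(1 <= n < N.+1 | (d * n <= N)%N && (k %| n)%N)
    mu k * f (d * n)%N).
  rewrite !big_nat; apply: eq_bigr => k /andP[k0 _].
  rewrite /X mulr_sumr; under [RHS]eq_bigl do rewrite andbC.
  rewrite (@sum_multiples k (fun n => d * n <= N)%N (fun n => mu k * f (d * n)%N))//.
  rewrite [LHS]big_nat_cond [RHS]big_nat_cond; apply: eq_big => [l|l _].
    by case: (1 <= l < N.+1)%N => //=; nia.
  by rewrite mulnCA mulnA.
rewrite (exchange_big_dep (fun n => d * n <= N)%N)/=; last by move=> k n _ /andP[].
transitivity (\sum_(1 <= n < N.+1) (n == 1%N)%:R * (if (d * n <= N)%N then f (d * n)%N else 0)).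
  rewrite big_mkcond !big_nat; apply: eq_bigr => n nN.
  case: ifP => dn; last by rewrite mulr0.
  rewrite -mu_inv// mulr_suml.
  by apply: eq_bigl => k; rewrite dn.
by rewrite sum_eq1 muln1 dN; case: ltnP => //; lia.
Qed.

(** In Dirichlet convolutions, with [delta] the unit and [1] the constant function,
    [c = delta - mu1 * 1]. Since [mu * 1 = delta], the product [mu2 * c] equals
    [mu2 - mu1 + mu1 * mu1 * 1], and adding [2 mu1 - mu1 * mu1 * 1] leaves [mu1 + mu2 = mu]. *)
Lemma vaughan :
  \sum_(1 <= n < N.+1) mu n * f n =
    \sum_(1 <= n < N.+1) mu1 n * f n *+ 2
    - \sum_(1 <= d < N.+1) \sum_(1 <= e < N.+1) mu1 d * mu1 e * X d e
    + \sum_(1 <= k < N.+1) mu2 k *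
        \sum_(1 <= m < N.+1 | (k * m <= N)%N) c m * f (k * m)%N.
Proof.
have T2E k : (0 < k <= N)%N ->
    \sum_(1 <= m < N.+1 | (k * m <= N)%N) c m * f (k * m)%N =
    f k - \sum_(1 <= d < N.+1) mu1 d * X k d.
  move=> /andP[k0 kN].
  under eq_bigr do rewrite cE mulrBl.
  rewrite big_split/= sumrN; congr (_ - _).
    rewrite big_mkcond/= (eq_bigr (fun m => (m == 1%N)%:R *
       (if (k * m <= N)%N then f (k * m)%N else 0))); last first.
      by move=> m _; case: ifP => //; rewrite mulr0.
    by rewrite sum_eq1 muln1 kN; case: ltnP => //; lia.
  under [LHS]eq_bigr do rewrite mulr_suml.
  rewrite (exchange_big_dep predT)//= !big_nat; apply: eq_bigr => d /andP[d0 _].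
  rewrite /X mulr_sumr; under eq_bigl do rewrite andbC.
  rewrite (@sum_multiples d (fun m => k * m <= N)%N (fun m => mu1 d * f (k * m)%N))//.
  rewrite [LHS]big_nat_cond [RHS]big_nat_cond; apply: eq_big => [l|l _].
    by case: (1 <= l < N.+1)%N => //=; nia.
  by rewrite mulnA.
have -> : \sum_(1 <= k < N.+1) mu2 k *
    \sum_(1 <= m < N.+1 | (k * m <= N)%N) c m * f (k * m)%N =
    \sum_(1 <= k < N.+1) (mu k - mu1 k) * (f k - \sum_(1 <= d < N.+1) mu1 d * X k d).
  by rewrite !big_nat; apply: eq_bigr => k kN; rewrite T2E// [mu k]muD addrAC subrr add0r.
have H : \sum_(1 <= k < N.+1) mu k * (\sum_(1 <= d < N.+1) mu1 d * X k d) =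
    \sum_(1 <= d < N.+1) mu1 d * f d.
  under eq_bigr do rewrite mulr_sumr.
  rewrite exchange_big/= !big_nat; apply: eq_bigr => d dN.
  by rewrite -(hyperbola_moebius dN) mulr_sumr; apply: eq_bigr => k _; rewrite mulrCA.
have -> : \sum_(1 <= d < N.+1) \sum_(1 <= e < N.+1) mu1 d * mu1 e * X d e =
    \sum_(1 <= k < N.+1) mu1 k * (\sum_(1 <= d < N.+1) mu1 d * X k d).
  by apply: eq_bigr => k _; rewrite mulr_sumr; apply: eq_bigr => d _; rewrite mulrA.
have -> : \sum_(1 <= k < N.+1) (mu k - mu1 k) *
      (f k - \sum_(1 <= d < N.+1) mu1 d * X k d) =
    \sum_(1 <= k < N.+1) mu k * f k - \sum_(1 <= k < N.+1) mu1 k * f k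
    - \sum_(1 <= k < N.+1) mu k * (\sum_(1 <= d < N.+1) mu1 d * X k d)
    + \sum_(1 <= k < N.+1) mu1 k * (\sum_(1 <= d < N.+1) mu1 d * X k d).
  by rewrite -!sumrB -big_split/=; apply: eq_bigr => k _; ring.
by rewrite H sumrMnl; ring.
Qed.

End Vaughan.

(** * Type I and type II sums *)

(** After symmetrising in [k] and [l], the difference of the two sides is a sum of the terms
    [(l x_l - k x_k)^2 / (2 k l)]. *)
Lemma weighted_cauchy_schwarz (R : realType) (r : seq nat) (x : nat -> R) :
    {in r, forall k, (0 < k)%N} ->
  (\sum_(k <- r) x k) ^+ 2 <=
    (\sum_(k <- r) k%:R^-1) * (\sum_(k <- r) k%:R * x k ^+ 2).
Proof.
move=> r0; set S := \sum_(k <- r) x k; set P := \sum_(k <- r) _; set Q := \sum_(k <- r) _.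
have -> : P * Q = \sum_(k <- r) \sum_(l <- r)
    (k%:R^-1 * (l%:R * x l ^+ 2) + l%:R^-1 * (k%:R * x k ^+ 2)) / 2.
  under eq_bigr do rewrite -mulr_suml big_split/= -mulr_suml -mulr_sumr.
  by rewrite -mulr_suml big_split/= -mulr_suml -mulr_sumr -/P -/Q; field.
rewrite expr2 {1}/S mulr_suml !big_seq ler_sum// => k kr.
rewrite /S mulr_sumr !big_seq ler_sum// => l lr.
have k0 : 0 < k%:R :> R by rewrite ltr0n r0.
have l0 : 0 < l%:R :> R by rewrite ltr0n r0.
rewrite -subr_ge0 (_ : _ - _ = (l%:R * x l - k%:R * x k) ^+ 2 / (2 * k%:R * l%:R)).
  by rewrite divr_ge0 ?sqr_ge0// !mulr_ge0.
by field; rewrite !gt_eqF.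
Qed.

Section TypeSums.
Variables (R : realType) (alpha : R) (N U : nat) (D : R).
Hypothesis alphaP : forall h, (0 < h)%N -> sin (pi * (alpha * h%:R)) != 0.
Hypotheses (U0 : (0 < U)%N) (UN : (U * U <= N)%N).
Hypothesis tauD : forall n, (0 < n <= N)%N -> (tau n)%:R <= D.

Let U_le_N : (U <= N)%N. Proof. by move: UN U0; nia. Qed.

Let D0 : 0 <= D.
Proof. by apply: le_trans (tauD (n := 1) _) => //; move: UN U0; nia. Qed.

Let mu n : R[i] := (moebius n)%:~R.
Let mu1 n : R[i] := if (n <= U)%N then mu n else 0.
Let mu2 n : R[i] := if (n <= U)%N then 0 else mu n.
Let c m : R[i] := (m == 1%N)%:R - \sum_(1 <= d < N.+1 | (d %| m)%N) mu1 d.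
Let f n : R[i] := expi2pi (alpha * n%:R).

Let cabs_mu n : cabs (mu n) <= 1.
Proof. by rewrite /mu cabs_int -[1]/(1%:~R) ler_int moebius_norm_le1. Qed.

Let cabs_mu1 n : cabs (mu1 n) <= (n <= U)%N%:R.
Proof. by rewrite /mu1; case: ifP => // _; rewrite /cabs normr0. Qed.

Let mu_inv n : (0 < n <= N)%N ->
  \sum_(1 <= d < N.+1 | (d %| n)%N) mu d = (n == 1%N)%:R.
Proof.
move=> nN; rewrite /mu -rmorph_sum/= (sum_moebius nN).
by case: (n == 1%N).
Qed.

(** All divisors of such an [m] are at most [U], where [mu1] agrees with [mu]. Thus both variables
    of the type II sum exceed [U]. *)
Let c_small m : (0 < m <= U)%N -> c m = 0.
Proof.
move=> /andP[m0 mU]; rewrite /c (_ : \sum_(1 <= d < N.+1 | _) _ = (m == 1%N)%:R) ?subrr//.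
rewrite -mu_inv; last by rewrite m0 (leq_trans mU).
apply: eq_bigr => d dm; rewrite /mu1 ifT//.
exact: leq_trans (dvdn_leq m0 dm) mU.
Qed.

Let cabs_c m : (0 < m <= N)%N -> cabs (c m) <= D.
Proof.
move=> mN; have /andP[m0 _] := mN; have [mU|mU] := leqP m U.
  by rewrite c_small ?m0// /cabs normr0.
rewrite /c gtn_eqF ?(leq_ltn_trans U0)// sub0r cabsN.
apply: le_trans (tauD mN); apply: le_trans (cabs_sum _ _ _) _.
rewrite sum_dvdn_divisors// /tau -sum1_size natr_sum.
by apply: ler_sum => d _; apply: le_trans (cabs_mu1 _) _; case: (_ <= _)%N.
Qed.

Lemma sum_mul_le t (g : nat -> R[i]) : (0 < t)%N ->
  \sum_(1 <= l < N.+1 | (t * l <= N)%N) g l = \sum_(1 <= l < (N %/ t).+1) g l.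
Proof.
move=> t0; rewrite [RHS](big_nat_widen _ _ N.+1)/=; last by rewrite ltnS leq_div.
by apply: eq_bigl => l; rewrite ltnS leq_divRL// mulnC.
Qed.

Lemma natr_div_le (a b : nat) : (a %/ b)%:R <= a%:R / b%:R :> R.
Proof.
case: b => [|b]; first by rewrite divn0 invr0 mulr0.
by rewrite ler_pdivlMr// -natrM ler_nat leq_trunc_div.
Qed.

(** * Type I sums *)

Lemma inner_type1 t : (0 < t)%N ->
  cabs (\sum_(1 <= l < N.+1 | (t * l <= N)%N) f (t * l)%N) <= minw alpha N t.
Proof.
move=> t0; rewrite sum_mul_le//.
under eq_bigr do rewrite /f natrM mulrA.
rewrite le_min; apply/andP; split.
  rewrite (le_trans (geometric_sum_le_card _ _ _))// subn1/=.
  exact: natr_div_le.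
exact/geometric_sum_le_sin/alphaP.
Qed.

(** A factorisation [t = d * e] is determined by the divisor [d] of [t]. *)
Lemma sum_tau (w : nat -> R) : (forall t, 0 <= w t) ->
  \sum_(1 <= d < U.+1) \sum_(1 <= e < U.+1) w (d * e)%N
    <= \sum_(1 <= t < (U * U).+1) (tau t)%:R * w t.
Proof.
move=> w0.
apply: (@le_trans _ _ (\sum_(1 <= d < (U * U).+1)
    \sum_(1 <= t < (U * U).+1 | (d %| t)%N && true) w t)).
  apply: (@le_trans _ _ (\sum_(1 <= d < U.+1)
    \sum_(1 <= t < (U * U).+1 | (d %| t)%N && true) w t)); last first.
    by apply: sumr_nat_widen => [k|]; [exact: sumr_ge0|nia].
  rewrite !big_nat ler_sum// => d /andP[d0 dU].
  rewrite (@sum_multiples R (U * U) d predT w)//.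
  rewrite (big_nat_widen 1 U.+1 (U * U).+1); last nia.
  rewrite big_mkcond [leRHS]big_mkcond/= ler_sum// => l _.
  by case: ifP => h; case: ifP => h' //; nia.
rewrite (exchange_big_dep predT)//= !big_nat ler_sum// => t /andP[t0 tU].
under eq_bigl do rewrite andbT.
rewrite sum_dvdn_divisors; last by rewrite t0.
by rewrite big_const_seq count_predT iter_addr_0 mulr_natl.
Qed.

Lemma type1_bound :
  cabs (\sum_(1 <= d < N.+1) \sum_(1 <= e < N.+1) mu1 d * mu1 e *
      \sum_(1 <= l < N.+1 | (d * e * l <= N)%N) f (d * e * l)%N)
    <= D * \sum_(1 <= t < (U * U).+1) minw alpha N t.
Proof.
have wid (F : nat -> R) : \sum_(1 <= d < N.+1) (d <= U)%N%:R * F d =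
    \sum_(1 <= d < U.+1) F d.
  rewrite [RHS](big_nat_widen _ _ N.+1)//= [RHS]big_mkcond/=.
  by apply: eq_bigr => d _; rewrite ltnS; case: ifP; rewrite ?mul1r ?mul0r.
apply: (@le_trans _ _ (\sum_(1 <= d < U.+1) \sum_(1 <= e < U.+1) minw alpha N (d * e))).
  rewrite -wid; apply: le_trans (cabs_sum _ _ _) _.
  rewrite !big_nat ler_sum// => d /andP[d0 _].
  rewrite -wid mulr_sumr; apply: le_trans (cabs_sum _ _ _) _.
  rewrite !big_nat ler_sum// => e /andP[e0 _].
  rewrite !cabsM mulrA ler_pM ?mulr_ge0 ?cabs_ge0//; first by rewrite ler_pM ?cabs_ge0.
  by apply: inner_type1; rewrite muln_gt0 d0.
apply: le_trans (sum_tau (minw_ge0 _ _)) _.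
rewrite mulr_sumr !big_nat ler_sum// => t /andP[t0 tU].
rewrite ler_wpM2r ?minw_ge0// tauD// t0 /=; lia.
Qed.

(** * Type II sums *)

Let H := (N %/ U)%N.
Let W := \sum_(1 <= h < H.+1) minw alpha N h.
Let HN : (H <= N)%N. Proof. exact: leq_div. Qed.

Lemma minw0 : minw alpha N 0 = 0.
Proof.
by rewrite /minw /isin invr0 !mulr0 sin0 normr0 invr0 minxx.
Qed.

(** Subtraction is truncated, so the argument is [|m1 - m|]. Each positive distance occurs at most
    once on either side of [m1], and distance [0] contributes [0]. *)
Lemma sum_minw_dist m1 : (m1 <= H)%N ->
  \sum_(1 <= m < H.+1) minw alpha N (m1 - m + (m - m1)) <= 2 * W.
Proof.
move=> mH.
have -> : \sum_(1 <= m < H.+1) minw alpha N (m1 - m + (m - m1)) =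
   \sum_(1 <= m < H.+1) minw alpha N (m1 - m) + \sum_(1 <= m < H.+1) minw alpha N (m - m1).
  rewrite -big_split/=; apply: eq_bigr => m _.
  by case: (leqP m1 m) => h; [rewrite (eqP h) minw0 add0r|
     rewrite (eqP (ltnW h)) addn0 minw0 addr0].
rewrite mulr_natl mulr2n lerD//.
  have [m10|m10] := posnP m1.
    by rewrite m10 big1 ?sumr_ge0// => [k _|k _]; rewrite ?minw_ge0 ?sub0n ?minw0.
  rewrite (big_cat_nat (n := m1))//=; last exact: leqW.
  rewrite [X in _ + X]big_nat [X in _ + X]big1 ?addr0; last first.
    by move=> m /andP[h _]; rewrite (eqP h) minw0.
  rewrite big_nat_rev/= big_nat.
  rewrite (eq_bigr (minw alpha N)); last first.
    by move=> m hm; congr (minw alpha N _); lia.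
  by rewrite -big_nat; apply: sumr_nat_widen => [k|]; [exact: minw_ge0|exact: leqW].
rewrite (big_cat_nat (n := m1.+1))//=.
rewrite big_nat big1 ?add0r; last first.
  by move=> m /andP[_ h]; rewrite (eqP (_ : m <= m1)%N) ?minw0.
rewrite -add1n big_addn.
under eq_bigr do rewrite addnK.
by apply: sumr_nat_widen => [k|]; [exact: minw_ge0|lia].
Qed.

Let corr m1 m2 : R[i] := \sum_(U.+1 <= k < N.+1 | (k * m1 <= N)%N && (k * m2 <= N)%N)
  k%:R * (f (k * m1) * (f (k * m2))^*%C).

Lemma corr_range m1 m2 : (0 < m1)%N -> (0 < m2)%N ->
  corr m1 m2 = \sum_(U.+1 <= k < (N %/ maxn m1 m2).+1)
     k%:R * expi2pi (alpha * (m1%:R - m2%:R) * k%:R).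
Proof.
move=> m10 m20; rewrite [RHS](big_nat_widen _ _ N.+1)/=; last by rewrite ltnS leq_div.
rewrite /corr; apply: eq_big => [k|k _].
  rewrite ltnS leq_divRL; last by rewrite leq_max m10.
  by rewrite maxnE; nia.
by rewrite /f -expi2piN -expi2piD !natrM; congr (_ * expi2pi _); ring.
Qed.

(** The range of [k] ends at [N / max(m1, m2)], which is at most [N / m1] and at most
    [N / |m1 - m2|]. The first bounds the weight [k]; the second caps the geometric sum, so the same
    [minw] as in type I appears. The diagonal does not oscillate and is bounded trivially. *)
Lemma cabs_corr m1 m2 : (0 < m1)%N -> (0 < m2)%N ->
  cabs (corr m1 m2) <= N%:R / m1%:R *
    (minw alpha N (m1 - m2 + (m2 - m1)) + (m1 == m2)%:R * (N%:R / m1%:R)).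
Proof.
move=> m10 m20; rewrite corr_range//; set b := (N %/ maxn m1 m2)%N.
have bm (m : nat) : (m <= maxn m1 m2)%N -> (0 < m)%N -> b%:R <= N%:R / m%:R :> R.
  move=> mm m0; apply: le_trans (natr_div_le _ _) _.
  rewrite ler_wpM2l// lef_pV2 ?posrE ?ltr0n ?ler_nat//.
  by rewrite leq_max m10.
have bm1 : b%:R <= N%:R / m1%:R :> R by apply: bm; rewrite ?leq_maxl.
have card_le a' : (0 < a')%N -> cabs (\sum_(a' <= k < b.+1)
    expi2pi (alpha * (m1%:R - m2%:R) * k%:R)) <= b%:R.
  move=> a0; apply: le_trans (geometric_sum_le_card _ _ _) _.
  by rewrite ler_nat; lia.
have [m12|m12] := eqVneq m1 m2.
  have -> : (m1 - m2 + (m2 - m1) = 0)%N by rewrite m12 subnn.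
  rewrite minw0 add0r mul1r.
  by apply: le_trans (weighted_geometric_sum_le _ card_le) _; rewrite ler_pM.
rewrite mul0r addr0.
have h0 : (0 < m1 - m2 + (m2 - m1))%N by lia.
have sE : `|sin (pi * (alpha * (m1%:R - m2%:R)))|^-1 = isin alpha (m1 - m2 + (m2 - m1)).
  rewrite /isin; case: (leqP m1 m2) => h.
    rewrite (eqP h) add0n natrB// -[in RHS]opprB !mulrN sinN normrN//.
  by rewrite (eqP (ltnW h)) addn0 natrB// ltnW.
apply: le_trans (weighted_geometric_sum_le
   (M := minw alpha N (m1 - m2 + (m2 - m1))) _ _) _; last first.
  by rewrite ler_wpM2r ?minw_ge0.
move=> a' a0; rewrite /minw le_min; apply/andP; split.
  by apply: le_trans (card_le _ a0) _; apply: bm => //; lia.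
rewrite -sE; apply: geometric_sum_le_sin.
by have := alphaP h0; rewrite -normr_gt0 -invr_gt0 -/(isin _ _) -sE invr_gt0 normr_gt0.
Qed.

Lemma corr_eq0 m1 m2 : (0 < m1)%N -> (0 < m2)%N -> (H < maxn m1 m2)%N -> corr m1 m2 = 0.
Proof.
move=> m10 m20; rewrite /H ltn_divLR// => h; rewrite corr_range// big_geq//.
by rewrite ltnS -ltnS ltn_divLR ?leq_max ?m10//; nia.
Qed.

Let L := harm R N.
Let g k : R[i] := \sum_(1 <= m < N.+1 | (k * m <= N)%N) c m * f (k * m)%N.
Let E : R := \sum_(U.+1 <= k < N.+1) k%:R * cabs (g k) ^+ 2.

Lemma type2_expand :
  E%:C = \sum_(1 <= m1 < N.+1) \sum_(1 <= m2 < N.+1) c m1 * (c m2)^*%C * corr m1 m2.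
Proof.
pose G k m : R[i] := if (k * m <= N)%N then c m * f (k * m)%N else 0.
transitivity (\sum_(U.+1 <= k < N.+1) \sum_(1 <= m1 < N.+1) \sum_(1 <= m2 < N.+1)
   k%:R * (G k m1 * (G k m2)^*%C)).
  rewrite rmorph_sum/=; apply: eq_bigr => k _.
  rewrite rmorphM/= rmorph_nat cabs_sqr /g big_mkcond/= rmorph_sum/=.
  rewrite mulr_suml mulr_sumr; apply: eq_bigr => m1 _.
  by rewrite mulr_sumr mulr_sumr.
rewrite exchange_big/=; apply: eq_bigr => m1 _.
rewrite exchange_big/=; apply: eq_bigr => m2 _.
rewrite /corr mulr_sumr [RHS]big_mkcond/=; apply: eq_bigr => k _; rewrite /G.
case: (k * m1 <= N)%N; case: (k * m2 <= N)%N; rewrite ?(conjc0, mul0r, mulr0)//.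
by rewrite rmorphM/=; ring.
Qed.

(** Only [U < m1 <= H] contributes. For fixed [m1] the sum over [m2] costs [N / m1] times [2 W] plus
    the diagonal [N / m1 <= N / U]; summing [1 / m1] gives [L]. *)
Lemma type2_second_moment : E <= D ^+ 2 * N%:R * L * (2 * W + N%:R / U%:R).
Proof.
have E0 : 0 <= E by apply: sumr_ge0 => k _; rewrite mulr_ge0// sqr_ge0.
have W0 : 0 <= W by apply: sumr_ge0 => k _; rewrite minw_ge0.
have NU0 : 0 <= N%:R / U%:R :> R by rewrite divr_ge0.
rewrite -[E]ger0_norm// -cabs_real type2_expand.
apply: le_trans (cabs_sum _ _ _) _.
apply: (@le_trans _ _ (\sum_(1 <= m1 < N.+1)
    D ^+ 2 * N%:R * (2 * W + N%:R / U%:R) * m1%:R^-1)); last first.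
  by rewrite -mulr_sumr -/(harm R N) -/L mulrAC.
rewrite !big_nat ler_sum// => m1 /andP[m10 m1N].
have B0 : 0 <= D ^+ 2 * N%:R * (2 * W + N%:R / U%:R) * m1%:R^-1.
  by rewrite !mulr_ge0 ?invr_ge0 ?addr_ge0 ?sqr_ge0// mulr_ge0.
have [m1U|m1U] := leqP m1 U.
  rewrite big1 ?[cabs 0]/cabs ?normr0// => m2 _.
  by rewrite c_small ?m10// !mul0r.
have [m1H|m1H] := leqP m1 H; last first.
  rewrite big_nat big1 ?[cabs 0]/cabs ?normr0// => m2 /andP[m20 _].
  by rewrite corr_eq0 ?mulr0// leq_max m1H.
apply: le_trans (cabs_sum _ _ _) _.
pose B m2 : R := N%:R / m1%:R *
    (minw alpha N (m1 - m2 + (m2 - m1)) + (m1 == m2)%:R * (N%:R / m1%:R)).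
have Bm2 m2 : 0 <= B m2.
  by rewrite mulr_ge0 ?divr_ge0// addr_ge0 ?minw_ge0// mulr_ge0// divr_ge0.
apply: (@le_trans _ _ (\sum_(1 <= m2 < H.+1) D ^+ 2 * B m2)).
  rewrite [leRHS](big_nat_widen _ _ N.+1)//= [leRHS]big_mkcond/=.
  rewrite !big_nat ler_sum// => m2 /andP[m20 m2N]; rewrite ltnS.
  case: leqP => m2H; last by rewrite corr_eq0 ?mulr0 ?[cabs 0]/cabs ?normr0// leq_max m2H orbT.
  rewrite !cabsM ler_pM ?mulr_ge0 ?cabs_ge0 ?cabs_corr//.
  rewrite expr2 ler_pM ?cabs_ge0 ?cabs_c ?m10//.
  by rewrite [cabs _^*%C]/cabs normcJ -/(cabs _) cabs_c ?m20.
rewrite -mulr_sumr /B -mulr_sumr big_split/=.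
have h2 : \sum_(1 <= m2 < H.+1) (m1 == m2)%:R * (N%:R / m1%:R) <= N%:R / U%:R :> R.
  apply: (@le_trans _ _ (N%:R / m1%:R)); last first.
    by rewrite ler_wpM2l// lef_pV2 ?posrE ?ltr0n// ler_nat ltnW.
  rewrite (bigD1_seq m1) ?mem_index_iota ?iota_uniq ?m10//= eqxx mul1r.
  by rewrite big1 ?addr0// => m2 h; rewrite eq_sym (negbTE h) mul0r.
have h1 := sum_minw_dist m1H.
have -> : D ^+ 2 * N%:R * (2 * W + N%:R / U%:R) * m1%:R^-1 =
  D ^+ 2 * (N%:R / m1%:R * (2 * W + N%:R / U%:R)) by ring.
rewrite ler_wpM2l ?sqr_ge0// ler_wpM2l ?divr_ge0//.
exact: lerD.
Qed.

Lemma type2_bound :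
  cabs (\sum_(1 <= k < N.+1) mu2 k * g k) ^+ 2
    <= L ^+ 2 * D ^+ 2 * N%:R * (2 * W + N%:R / U%:R).
Proof.
have h1 : cabs (\sum_(1 <= k < N.+1) mu2 k * g k) <= \sum_(U.+1 <= k < N.+1) cabs (g k).
  rewrite (big_cat_nat (n := U.+1))//= big_nat big1 ?add0r; last first.
    by move=> k /andP[_ kU]; rewrite /mu2 -ltnS kU mul0r.
  apply: le_trans (cabs_sum _ _ _) _; apply: ler_sum => k _.
  rewrite cabsM ler_piMl ?cabs_ge0// /mu2; case: ifP => // _.
  by rewrite /cabs normr0.
apply: (@le_trans _ _ ((\sum_(U.+1 <= k < N.+1) cabs (g k)) ^+ 2)).
  by rewrite lerXn2r ?nnegrE ?cabs_ge0// sumr_ge0// => k _; exact: cabs_ge0.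
apply: le_trans (weighted_cauchy_schwarz _ _) _.
  by move=> k; rewrite mem_index_iota => /andP[/(leq_trans _)->].
rewrite (_ : L ^+ 2 * D ^+ 2 * N%:R * (2 * W + N%:R / U%:R) =
  L * (D ^+ 2 * N%:R * L * (2 * W + N%:R / U%:R))); last by ring.
apply: ler_pM; rewrite ?sumr_ge0//.
- by move=> k _; rewrite mulr_ge0 ?sqr_ge0.
- by rewrite /L /harm [leRHS](big_cat_nat (n := U.+1))//= lerDr sumr_ge0.
- exact: type2_second_moment.
Qed.

(** [B] majorises the square root of the type II bound, so a convenient perfect square can be chosen
    later. *)
Lemma moebius_exp_sum_split (B : R) : 0 <= B ->
    L ^+ 2 * D ^+ 2 * N%:R * (2 * W + N%:R / U%:R) <= B ^+ 2 ->
  cabs (\sum_(1 <= n < N.+1) (moebius n)%:~R * f n) <=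
    2 * U%:R + D * (\sum_(1 <= t < (U * U).+1) minw alpha N t) + B.
Proof.
move=> B0 hB.
rewrite (@vaughan _ N f mu mu1 mu2 c mu_inv)//; last first.
  by move=> n; rewrite /mu1 /mu2; case: ifP => _; rewrite ?addr0 ?add0r.
apply: le_trans (cabsD _ _) _; apply: lerD; last first.
  rewrite -[leRHS]ger0_norm// -[leLHS]ger0_norm ?cabs_ge0// -ler_sqr ?nnegrE//.
  by rewrite !real_normK ?num_real//; apply: le_trans hB; exact: type2_bound.
apply: le_trans (cabsD _ _) _; rewrite cabsN; apply: lerD; last exact: type1_bound.
apply: le_trans (cabs_sum _ _ _) _.
apply: (@le_trans _ _ (\sum_(1 <= n < N.+1) (if (n <= U)%N then 2 else 0))).
  apply: ler_sum => n _; rewrite -mulr_natl !cabsM cabs_expi2pi mulr1.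
  have -> : cabs 2%:R = 2 :> R by exact: (cabs_int R 2).
  rewrite /mu1; case: ifP => _; last by rewrite [cabs 0]/cabs normr0 mulr0.
  by rewrite ger_pMr.
rewrite -big_mkcond/=.
rewrite (_ : \sum_(1 <= n < N.+1 | (n <= U)%N) 2 = \sum_(1 <= n < U.+1) 2).
  by rewrite sumr_const_nat subn1/= mulr_natr.
by rewrite [RHS](big_nat_widen _ _ N.+1).
Qed.

End TypeSums.

(** * Rational approximations *)

Section Approximation.
Variables (R : realType) (alpha : R).

(** Pigeonhole: the fractional parts of [alpha * i] for [0 <= i <= Q] fall into [Q] boxes of length
    [1 / Q]. Cancelling the common factor of [a] and [q] increases neither [q] nor the error. *)
Lemma dirichlet_approx Q : (0 < Q)%N -> exists (a : int) (q : nat),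
  [/\ (0 < q <= Q)%N, coprime `|a| q & `|q%:R * alpha - a%:~R| <= Q%:R^-1].
Proof.
move=> Q0; have QR0 : 0 < Q%:R :> R by rewrite ltr0n.
suff [a [q [qQ h]]] : exists (a : int) (q : nat),
    (0 < q <= Q)%N /\ `|q%:R * alpha - a%:~R| <= Q%:R^-1.
  have /andP[q0 qle] := qQ; set g := gcdn `|a| q.
  have g0 : (0 < g)%N by rewrite gcdn_gt0 q0 orbT.
  have qE : (q = q %/ g * g)%N by rewrite divnK// dvdn_gcdr.
  have aE : a = (a %/ g)%Z * g by rewrite divzK// /g dvdzE dvdn_gcdl.
  have q'0 : (0 < q %/ g)%N by rewrite divn_gt0// dvdn_leq// dvdn_gcdr.
  exists (a %/ g)%Z, (q %/ g)%N; split.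
  - by rewrite q'0 (leq_trans (leq_div _ _)).
  - rewrite /coprime -(eqn_pmul2r g0) muln_gcdl mul1n -qE.
    by rewrite (_ : `|(a %/ g)%Z| * g = `|a|)%N// [in RHS]aE abszM.
  have qR : q%:R = (q %/ g)%:R * g%:R :> R by rewrite -natrM -qE.
  have aR : a%:~R = (a %/ g)%Z%:~R * g%:R :> R by rewrite [in LHS]aE intrM.
  apply: le_trans h; rewrite [in leRHS]qR [in leRHS]aR mulrAC -mulrBl normrM.
  by rewrite ler_peMr// ger0_norm// ler1n.
pose fr (i : nat) : R := alpha * i%:R - (Num.floor (alpha * i%:R))%:~R.
have fr0 i : 0 <= fr i by rewrite subr_ge0 floor_le.
have fr1 i : fr i < 1.
  by rewrite ltrBlDr addrC; have := floorD1_gt (alpha * i%:R); rewrite intrD.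
have tr (i : nat) : (Num.truncn (Q%:R * fr i) < Q)%N.
  by rewrite truncn_lt_nat ?mulr_ge0// gtr_pMr.
pose F (i : 'I_Q.+1) := Ordinal (tr i).
have /injectivePn[i [j ij FE]] : ~~ injectiveb F.
  apply/negP => /injectiveP /leq_card; rewrite !card_ord; lia.
have {FE} : Num.truncn (Q%:R * fr i) = Num.truncn (Q%:R * fr j) by case: FE.
wlog lij : i j ij / (i < j)%N.
  move=> hw; case: (ltngtP i j) => h FE; first exact: hw FE.
    by apply: (hw j i) => //; rewrite eq_sym.
  by move: ij; rewrite -val_eqE /= h eqxx.
move=> FE; exists (Num.floor (alpha * j%:R) - Num.floor (alpha * i%:R)), (j - i)%N.
split; first by have := ltn_ord j; lia.
have -> : (j - i)%:R * alpha - (Num.floor (alpha * j%:R) - Num.floor (alpha * i%:R))%:~R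
    = fr j - fr i.
  by rewrite natrB ?(ltnW lij)// intrB /fr; ring.
have /andP[i1 i2] : (Num.truncn (Q%:R * fr i))%:R <= Q%:R * fr i < (Num.truncn (Q%:R * fr i)).+1%:R.
  by rewrite truncn_itv// mulr_ge0.
have /andP[j1 j2] : (Num.truncn (Q%:R * fr j))%:R <= Q%:R * fr j < (Num.truncn (Q%:R * fr j)).+1%:R.
  by rewrite truncn_itv// mulr_ge0.
rewrite -FE -natr1 in j1 j2; rewrite -natr1 in i2.
rewrite -[leRHS]mul1r ler_pdivlMr// -[X in _ * X]ger0_norm// -normrM ler_norml.
by apply/andP; split; lra.
Qed.

Hypothesis irr : irrational alpha.

Lemma irrational_neq (a : int) (q : nat) : (0 < q)%N -> alpha != a%:~R / q%:R.
Proof.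
move=> q0; apply/eqP => h; apply: irr; exists (a%:~R / q%:R) => //.
by rewrite h fmorph_div/= ratr_int ratr_nat.
Qed.

Lemma irrational_sin_neq0 h : (0 < h)%N -> sin (pi * (alpha * h%:R)) != 0.
Proof.
move=> h0; pose k := Num.floor (alpha * h%:R); pose y := alpha * h%:R - k%:~R.
have y0 : 0 < y.
  rewrite lt_neqAle subr_ge0 floor_le andbT eq_sym subr_eq0.
  apply/eqP => e; have /eqP := irrational_neq k h0; apply.
  by rewrite -e mulfK// pnatr_eq0 -lt0n.
have y1 : y < 1.
  by rewrite ltrBlDr addrC; have := floorD1_gt (alpha * h%:R); rewrite intrD.
rewrite (_ : alpha * h%:R = k%:~R + y); last by rewrite addrC subrK.
rewrite -normr_gt0 norm_sin_intD normr_gt0 gt_eqF// sin_gt0_pi//.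
by rewrite mulr_gt0 ?pi_gt0//= gtr_pMr ?pi_gt0.
Qed.

(** As [tau > eta], only finitely many pairs come closer than [q ^ (- tau)]. The constant [c] is the
    minimum of [1] and their distances, all positive; for these pairs [q ^ (- tau) <= 1]
    suffices. *)
Lemma finite_exponent_lower_bound (eta tau : R) :
    irrationality_exponent alpha = eta%:E -> eta < tau -> 0 <= tau ->
  exists2 c : R, 0 < c & forall (a : int) (q : nat), (0 < q)%N ->
    c * q%:R `^ (- tau) <= `|alpha - a%:~R / q%:R|.
Proof.
move=> etaE et tau0.
have /finite_seqP[s sE] : finite_set (approximations alpha tau).
  apply: contrapT => inf.
  suff : (tau%:E <= eta%:E)%E by rewrite lee_fin leNgt et.
  by rewrite -etaE; apply: ereal_sup_ubound; exists tau.
pose c := \big[Num.min/1]_(pq <- s) `|alpha - pq.1%:~R / pq.2%:~R|.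
have c0 : 0 < c.
  rewrite /c; rewrite big_seq; elim/big_ind: _ => // [x y x0 y0|pq pqs].
    by rewrite lt_min x0.
  have : [set` s] pq by [].
  by rewrite -sE => -[].
exists c => // a q q0.
have q1 : q%:R `^ (- tau) <= 1.
  rewrite powRN invf_le1 ?powR_gt0 ?ltr0n//.
  by rewrite -[leLHS](powRr0 q%:R) ler_powR// ler1n.
have [h|h] := leP (q%:R `^ (- tau)) `|alpha - a%:~R / q%:R|.
  by apply: le_trans h; rewrite ler_piMl ?powR_ge0// bigmin_le_id.
have aqs : (a, q%:Z) \in s.
  suff : [set` s] (a, q%:Z) by [].
  rewrite -sE; split=> //=.
  by rewrite normr_gt0 subr_eq0 irrational_neq.
apply: (@le_trans _ _ c); first by rewrite ler_piMr// ltW.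
have := @bigmin_inf_seq _ _ _ s 1 (a, q%:Z) xpredT `|alpha - a%:~R / q%:R|
  (fun pq => `|alpha - pq.1%:~R / pq.2%:~R|) aqs isT.
by apply.
Qed.

End Approximation.

(** * The estimate *)

Section Estimate.
Variables (R : realType) (alpha eta : R).
Hypotheses (irr : irrational alpha)
  (etaE : irrationality_exponent alpha = eta%:E) (eta2 : 2 <= eta).

Let powD (x r s : R) : 0 < x -> x `^ (r + s) = x `^ r * x `^ s.
Proof. by move=> x0; rewrite powRD//; apply/implyP => _; rewrite gt_eqF. Qed.

(* Dirichlet's theorem with [Q = N^(1 - 1/tau)]; the exponent [tau > eta] forces
   [q >= c N^(1/tau)]. *)
Lemma balanced_approx (tau : R) : eta < tau -> exists2 C : R, 0 < C &
  forall N, (0 < N)%N -> exists (a : int) (q : nat),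
    [/\ (0 < q)%N, coprime `|a| q, `|q%:R * alpha - a%:~R| <= q%:R^-1,
        q%:R <= N%:R `^ (1 - tau^-1) & N%:R / q%:R <= C * N%:R `^ (1 - tau^-1)].
Proof.
move=> et; have tau1 : 0 < tau - 1 by move: eta2; lra.
have tau0 : 0 < tau by lra.
have [c c0 hc] := finite_exponent_lower_bound irr etaE et (ltW tau0).
(* Comparing [c q ^ (- tau)] with the Dirichlet error [1 / (q Q)] gives [c Q <= q ^ (tau - 1)],
   where [Q >= y / 2]. Taking the root of order [tau - 1] turns [y] into [N ^ (1 / tau)] and [c / 2]
   into [c']. *)
pose c' := (c / 2) `^ ((tau - 1)^-1).
have c'0 : 0 < c' by apply: powR_gt0; apply: divr_gt0.
exists c'^-1; first by rewrite invr_gt0.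
move=> N N0; have NR0 : 0 < N%:R :> R by rewrite ltr0n.
have NR1 : 1 <= N%:R :> R by rewrite ler1n.
set y := N%:R `^ (1 - tau^-1).
have y1 : 1 <= y.
  rewrite -[leLHS](powRr0 N%:R) ler_powR// subr_ge0 invf_le1//; lra.
pose Q := Num.truncn y.
have Q0 : (0 < Q)%N by rewrite truncn_gt0.
have /andP[Qy yQ] : Q%:R <= y < Q.+1%:R by rewrite truncn_itv// (le_trans _ y1).
have y2Q : y <= 2 * Q%:R.
  rewrite (le_trans (ltW yQ))// -natr1 mulr_natl mulr2n lerD2l ler1n//.
have [a [q [/andP[q0 qQ] co h]]] := dirichlet_approx alpha Q0.
have qR0 : 0 < q%:R :> R by rewrite ltr0n.
exists a, q; split=> //.
- by apply: le_trans h _; rewrite lef_pV2 ?posrE ?ltr0n// ler_nat.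
- by apply: le_trans Qy; rewrite ler_nat.
have key : c * Q%:R <= q%:R `^ (tau - 1).
  have h1 : `|alpha - a%:~R / q%:R| <= (q%:R * Q%:R)^-1.
    rewrite invfM -(ler_pM2l qR0) mulrA divff ?gt_eqF// mul1r.
    rewrite -[X in X * `|_|]ger0_norm// -normrM mulrBr mulrCA divff ?gt_eqF// mulr1.
    by [].
  have := le_trans (hc a q q0) h1.
  rewrite powRN -[X in _ <= X -> _]mul1r ler_pdivlMr ?mulr_gt0 ?ltr0n//.
  rewrite mulrAC ler_pdivrMr ?powR_gt0// mul1r.
  rewrite mulrCA -[X in _ <= X -> _](mulr_powRB1 (ltW qR0) tau0).
  by rewrite ler_pM2l.
have qlow : c' * N%:R `^ (tau^-1) <= q%:R.
  have -> : q%:R = (q%:R `^ (tau - 1)) `^ ((tau - 1)^-1) :> R.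
    by rewrite -powRrM mulfV ?gt_eqF// powRr1// ltW.
  have -> : N%:R `^ (tau^-1) = y `^ ((tau - 1)^-1).
    rewrite /y -powRrM; congr (_ `^ _); field.
    by rewrite !gt_eqF.
  rewrite /c' -powRM ?divr_ge0 ?(ltW c0)// ?(le_trans _ y1)//.
  apply: le_powR2r; first by rewrite invr_ge0 ltW.
  apply/andP; split; first by rewrite mulr_ge0 ?divr_ge0 ?(ltW c0) ?(le_trans _ y1).
  apply: le_trans key; rewrite -mulrA ler_pM2l//; lra.
rewrite ler_pdivrMr//.
have NE : N%:R = c'^-1 * y * (c' * N%:R `^ (tau^-1)).
  by rewrite mulrACA mulVf ?gt_eqF// mul1r -powD// subrK powRr1.
by rewrite [leLHS]NE ler_wpM2l// mulr_ge0 ?invr_ge0 ?(ltW c'0)// (le_trans _ y1).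
Qed.

Lemma moebius_exp_sum_nat (theta eps : R) : 0 < eps ->
    4 / 5 <= theta <= 1 -> (2 * eta - 1) / (2 * eta) <= theta ->
  exists2 C : R, 0 <= C & forall N, (0 < N)%N ->
    cabs (\sum_(1 <= n < N.+1) (moebius n)%:~R * expi2pi (alpha * n%:R))
      <= C * N%:R `^ (theta + eps).
Proof.
move=> eps0 /andP[th45 th1] thE.
have eta0 : 0 < eta by move: eta2; lra.
(* In type I, [delta] is lost three times: divisor bound, logarithm, and the excess of [V]. In type
   II it is lost six times before the square root: [L ^ 3], [D ^ 2] and [P]. Both give exactly
   [eps]. *)
pose delta := eps / 3; have delta0 : 0 < delta by rewrite divr_gt0.
pose rho := eta + delta; have rho0 : 0 < rho by rewrite addr_gt0.
(* Moving from [eta] to [rho] costs [1/eta - 1/rho = delta / (eta rho) <= delta]. *)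
have exp_le : 1 - rho^-1 <= 2 * theta - 1 + delta.
  have e1 : 1 - eta^-1 <= 2 * theta - 1.
    have -> : 1 - eta^-1 = 2 * ((2 * eta - 1) / (2 * eta)) - 1 by field; rewrite gt_eqF.
    lra.
  have e2 : eta^-1 - rho^-1 <= delta.
    have -> : eta^-1 - rho^-1 = delta / (eta * rho) by rewrite /rho; field; rewrite !gt_eqF.
    rewrite ler_pdivrMr ?mulr_gt0// ler_peMr ?(ltW delta0)// /rho; move: eta2; nra.
  lra.
have [C1 C10 approx] : exists2 C : R, 0 < C &
  forall N, (0 < N)%N -> exists (a : int) (q : nat),
    [/\ (0 < q)%N, coprime `|a| q, `|q%:R * alpha - a%:~R| <= q%:R^-1,
        q%:R <= N%:R `^ (1 - rho^-1) & N%:R / q%:R <= C * N%:R `^ (1 - rho^-1)].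
  by apply: balanced_approx; rewrite /rho ltrDl.
have [CD [CD0 hD]] := tau_bound delta0.
have [CL [CL0 hL]] := harm_bound delta0.
(* [C1 + 3] collects [N/q <= C1 P], [q <= P] and [N/U <= 2 P]; [26] is twice the [12] of [minw_sum]
   plus [2] for the diagonal. *)
pose K := 26 * (C1 + 3) * CL ^+ 3 * CD ^+ 2.
have K0 : 0 <= K by rewrite !mulr_ge0 ?exprn_ge0//; lra.
exists (2 + 12 * CD * CL * (C1 + 2) + Num.sqrt K).
  by rewrite !addr_ge0 ?sqrtr_ge0// !mulr_ge0//; lra.
move=> N N0; have NR0 : 0 < N%:R :> R by rewrite ltr0n.
have NR1 : 1 <= N%:R :> R by rewrite ler1n.
have pow_le r s : r <= s -> N%:R `^ r <= N%:R `^ s :> R by move=> rs; rewrite ler_powR.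
have [a [q [q0 co h qle qge]]] := approx N N0.
pose x := N%:R `^ delta : R.
have x1 : 1 <= x by rewrite -[leLHS](powRr0 N%:R) pow_le// ltW.
pose P := N%:R `^ (2 * theta - 1 + delta) : R.
have P1 : N%:R `^ (1 - rho^-1) <= P by exact: pow_le.
have P0 : 0 < P by rewrite powR_gt0.
have qN : (q <= N)%N.
  rewrite -(ler_nat R) (le_trans qle)// -[leRHS]powRr1// pow_le//.
  by rewrite gerBl invr_ge0 ltW.
pose U := Num.truncn (N%:R `^ (2 / 5) : R).
have u1 : 1 <= N%:R `^ (2 / 5) :> R by rewrite -[leLHS](powRr0 N%:R) pow_le//; lra.
have U0 : (0 < U)%N by rewrite truncn_gt0.
have UR0 : 0 < U%:R :> R by rewrite ltr0n.
have /andP[Ule Ugt] : (U%:R <= (N%:R : R) `^ (2 / 5) < U.+1%:R).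
  by rewrite truncn_itv// (le_trans _ u1).
have UU : (U * U)%:R <= N%:R `^ (4 / 5) :> R.
  by rewrite natrM (_ : 4 / 5 = 2 / 5 + 2 / 5) ?powD ?ler_pM//; lra.
have UUN : (U * U <= N)%N.
  by rewrite -(ler_nat R) (le_trans UU)// -[leRHS]powRr1// pow_le//; lra.
(* [N / U] is of order [N ^ (3/5)], and [3/5 <= 2 theta - 1] is precisely [4/5 <= theta]. *)
have NU : N%:R / U%:R <= 2 * P.
  rewrite ler_pdivrMr//.
  have h1 : N%:R = N%:R `^ (3 / 5) * N%:R `^ (2 / 5) :> R.
    by rewrite -powD// (_ : 3 / 5 + 2 / 5 = 1) ?powRr1//; lra.
  have h2 : N%:R `^ (3 / 5) <= P by apply: pow_le; lra.
  have h3 : N%:R `^ (2 / 5) <= 2 * U%:R :> R.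
    by rewrite (le_trans (ltW Ugt))// -natr1 mulr_natl mulr2n lerD2l ler1n.
  rewrite [leLHS]h1 (_ : 2 * P * U%:R = P * (2 * U%:R)); last by ring.
  by rewrite ler_pM// powR_ge0.
pose D := CD * x.
have D0 : 0 <= D by rewrite mulr_ge0// (le_trans _ x1).
have tauD n : (0 < n <= N)%N -> (tau n)%:R <= D.
  move=> /andP[n0 nN]; apply: le_trans (hD n n0) _; rewrite ler_wpM2l//.
  by rewrite le_powR2r ?(ltW delta0)// ler0n ler_nat.
have LE : harm R N <= CL * x by exact: hL.
have L1 : 1 <= harm R N by exact: harm_ge1.
set L := harm R N in LE L1.
have L0 : 0 <= L by rewrite (le_trans _ L1).
have Nq : N%:R / q%:R <= C1 * P.
  by rewrite (le_trans qge)// ler_wpM2l// ltW.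
have qP : q%:R <= P by rewrite (le_trans qle).
pose Z := N%:R `^ (theta + eps) : R.
have Z0 : 0 <= Z by exact: powR_ge0.
pose V := N%:R `^ (theta + delta) : R.
(* [theta <= 1] gives [2 theta - 1 <= theta]. *)
have PV : P <= V by apply: pow_le; lra.
have UUV : (U * U)%:R <= V by rewrite (le_trans UU)// pow_le//; lra.
have ZE : Z = x ^+ 2 * V.
  rewrite /Z /V /x expr2 -!powD//; congr (_ `^ _); rewrite /delta; lra.
have ZZE : Z ^+ 2 = x ^+ 5 * N%:R * P.
  rewrite -[X in _ * X * _]powRr1// /Z /x /P !exprS expr0 !mulr1 -!powD//.
  by congr (_ `^ _); rewrite /delta; lra.
have W1 := minw_sum q0 co h qN UUN.
have W2 := minw_sum q0 co h qN (leq_div N U).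
rewrite -/L in W1 W2.
have {}W1 : \sum_(1 <= t < (U * U).+1) minw alpha N t <= 12 * L * ((C1 + 2) * V).
  apply: le_trans W1 _; rewrite ler_wpM2l ?mulr_ge0//.
  have : C1 * P <= C1 * V by rewrite ler_wpM2l// ltW.
  lra.
have {}W2 : 2 * (\sum_(1 <= t < (N %/ U).+1) minw alpha N t) + N%:R / U%:R
    <= 26 * L * ((C1 + 3) * P).
  have w : \sum_(1 <= t < (N %/ U).+1) minw alpha N t <= 12 * L * ((C1 + 3) * P).
    apply: le_trans W2 _; rewrite ler_wpM2l ?mulr_ge0//.
    have := natr_div_le R N U; lra.
  have : 1 * ((C1 + 3) * P) <= L * ((C1 + 3) * P).
    by rewrite ler_wpM2r// mulr_ge0 ?(ltW P0)//; lra.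
  have : 0 <= C1 * P by rewrite mulr_ge0 ?ltW.
  lra.
have B0 : 0 <= Num.sqrt K * Z by rewrite mulr_ge0// sqrtr_ge0.
have hB : L ^+ 2 * D ^+ 2 * N%:R *
    (2 * (\sum_(1 <= t < (N %/ U).+1) minw alpha N t) + N%:R / U%:R)
    <= (Num.sqrt K * Z) ^+ 2.
  apply: (@le_trans _ _ (L ^+ 2 * D ^+ 2 * N%:R * (26 * L * ((C1 + 3) * P)))).
    by rewrite ler_wpM2l// mulr_ge0// mulr_ge0// sqr_ge0.
  have -> : L ^+ 2 * D ^+ 2 * N%:R * (26 * L * ((C1 + 3) * P)) =
      L ^+ 3 * (26 * (C1 + 3) * D ^+ 2 * N%:R * P) by ring.
  apply: (@le_trans _ _ ((CL * x) ^+ 3 * (26 * (C1 + 3) * D ^+ 2 * N%:R * P))).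
    rewrite ler_wpM2r//.
      rewrite mulr_ge0 ?(ltW P0)// mulr_ge0// mulr_ge0 ?sqr_ge0//.
      by rewrite mulr_ge0//; lra.
    by rewrite lerXn2r ?nnegrE// (le_trans L0 LE).
  rewrite [leRHS]exprMn sqr_sqrtr// ZZE /K /D.
  by rewrite le_eqVlt; apply/orP; left; apply/eqP; ring.
have := moebius_exp_sum_split (irrational_sin_neq0 irr) U0 UUN tauD B0 hB.
move=> hS; apply: le_trans hS _.
rewrite -/Z [leRHS]mulrDl [X in _ <= X + _]mulrDl lerD2r; apply: lerD.
  rewrite ler_wpM2l// (le_trans Ule)// pow_le//; lra.
apply: (@le_trans _ _ (D * (12 * (CL * x) * ((C1 + 2) * V)))).
  rewrite ler_wpM2l// (le_trans W1)// ler_wpM2r ?ler_wpM2l//.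
  by rewrite mulr_ge0 ?powR_ge0//; lra.
by rewrite ZE /D le_eqVlt; apply/orP; left; apply/eqP; ring.
Qed.

Lemma moebius_exp_sum_near (theta eps : R) : 0 < eps ->
    4 / 5 <= theta <= 1 -> (2 * eta - 1) / (2 * eta) <= theta ->
  exists C : R, \forall x \near +oo,
    `|moebius_exp_sum alpha x| <= (C * x `^ (theta + eps))%:C.
Proof.
move=> eps0 th thE; have [C C0 hC] := moebius_exp_sum_nat eps0 th thE.
exists C; near=> x.
have x1 : 1 <= x by near: x; apply: nbhs_pinfty_ge; rewrite num_real.
rewrite /moebius_exp_sum cabsE lecR.
have N0 : (0 < Num.truncn x)%N by rewrite truncn_gt0.
apply: le_trans (hC _ N0) _; rewrite ler_wpM2l//.
rewrite le_powR2r ?ler0n//=; first by move: th; lra.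
by rewrite truncn_le (le_trans _ x1).
Unshelve. all: by end_near. Qed.

End Estimate.

Theorem theorem1 (R : realType) (alpha eta eps : R)
    (halpha : irrational alpha)
    (heta : irrationality_exponent alpha = eta%:E)
    (heps : 0 < eps) :
  (2 <= eta <= 5 / 2 ->
     exists C : R, \forall x \near +oo,
       `|moebius_exp_sum alpha x| <= (C * x `^ (4 / 5 + eps))%:C) /\
  (5 / 2 <= eta ->
     exists C : R, \forall x \near +oo,
       `|moebius_exp_sum alpha x|
         <= (C * x `^ ((2 * eta - 1) / (2 * eta) + eps))%:C).
Proof.
split=> [/andP[eta2 eta52]|eta52].
  (* [(2 eta - 1) / (2 eta) <= 4/5] holds exactly when [eta <= 5/2], so in each case [theta] is the
     larger of the two exponents. *)
  apply: (moebius_exp_sum_near halpha heta) => //; first by apply/andP; split; lra.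
  by rewrite ler_pdivrMr; lra.
apply: (moebius_exp_sum_near halpha heta) => //; first lra.
by apply/andP; split; rewrite ?ler_pdivlMr ?ler_pdivrMr; lra.
Qed.
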